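(* Let $S$ be a stable semigroup with finitely many $\mathscr J$-classes, $J_1,\dots, J_n$, with $J_1$ minimal, and suppose that $J_2,\dots,J_n$ are all $\mathscr H$-separable. For each $r=1,\dots,n$, let $\Gamma_r$ be the Schützenberger group of any $\mathscr H$-class of $J_r$. Suppose also that for some (equivalently, every) $\mathscr L$-class $L\subseteq J_1$ one of the following holds: $\mathscr H_L$ is the unique maximal congruence of ${}^S L$, or $\mathscr H_L=\nabla_L$; and that for some (equivalently, every) $\mathscr R$-class $R\subseteq J_1$ one of the following holds: $\mathscr H_R$ is the unique maximal congruence of $R^S$, or $\mathscr H_R=\nabla_R$. Fix an $\mathscr L$-class $L\subseteq J_1$ and an $\mathscr R$-class $R\subseteq J_1$. Then \[ \mathrm{Ht}(\mathrm{Cong}(S)) = \sum_{r=1}^n \mathrm{Ht}(\mathrm{NSub}(\Gamma_r))+ \begin{cases} 0 &\text{if } \mathscr H_L=\nabla_L \text{ and } \mathscr H_R=\nabla_R,\\ 1 &\text{if } \mathscr H_L=\nabla_L \text{ and } \mathscr H_R\neq\nabla_R,\\ 1 &\text{if } \mathscr H_L\neq\nabla_L \text{ and } \mathscr H_R=\nabla_R,\\ 2 &\text{if } \mathscr H_L\neq\nabla_L \text{ and } \mathscr H_R\neq\nabla_R. \end{cases} \]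
   Context: The height $\mathrm{Ht}(P)$ of a poset $P$ is the supremum of the cardinalities of chains in $P$. For a semigroup $S$, $S^1$ is $S$ if $S$ is a monoid and otherwise $S$ with an identity adjoined. Green's relations: $x\mathrel{\mathscr L}y\Leftrightarrow S^1x=S^1y$, $x\mathrel{\mathscr R}y\Leftrightarrow xS^1=yS^1$, $x\mathrel{\mathscr J}y\Leftrightarrow S^1xS^1=S^1yS^1$, $\mathscr H=\mathscr L\cap\mathscr R$. The $\mathscr J$-classes are ordered by $J_x\le J_y\Leftrightarrow S^1xS^1\subseteq S^1yS^1$; minimality refers to this order. A $\mathscr J$-class $J$ is stable if for all $x\in J$, $s\in S^1$: $x\mathrel{\mathscr J}sx\Rightarrow x\mathrel{\mathscr L}sx$ and $x\mathrel{\mathscr J}xs\Rightarrow x\mathrel{\mathscr R}xs$; $S$ is stable if all its $\mathscr J$-classes are stable. $\mathrm{Cong}(S)$ is the lattice of (two-sided) congruences of $S$. For $\mathscr L$-classes $L$ and $\mathscr R$-classes $R$ contained in the stable minimal $\mathscr J$-class $J_1$, one has $SL\subseteq L$ and $RS\subseteq R$. ${}^S L$ denotes the left $S$-act on $L$ by left multiplication, whose congruences are the equivalence relations $\sigma$ on $L$ with $(a,b)\in\sigma\Rightarrow(sa,sb)\in\sigma$ for all $s\in S$; $R^S$ denotes the right $S$-act on $R$ by right multiplication, whose congruences are the equivalence relations $\sigma$ on $R$ with $(a,b)\in\sigma\Rightarrow(as,bs)\in\sigma$ for all $s\in S$. For a set $X$, $\nabla_X=X\times X$. A congruence on an act $X$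 is maximal if it is not $\nabla_X$ and no congruence lies strictly between it and $\nabla_X$. $\mathscr H_L$ and $\mathscr H_R$ are the restrictions of $\mathscr H$ to $L$ and $R$. A stable $\mathscr J$-class $J$ is $\mathscr H$-separable if for all $x,y\in J$ with $(x,y)\notin\mathscr H$ there exist $s,t\in S^1$ such that precisely one of $sxt$, $syt$ belongs to $J$. The (right) Schützenberger group of an $\mathscr H$-class $H$ is the group, under composition, of all maps $H\to H$, $x\mapsto xt$, where $t\in S^1$ satisfies $Ht\subseteq H$; up to isomorphism it depends only on the $\mathscr D$-class containing $H$ (where $\mathscr D=\mathscr L\vee\mathscr R$), and a stable $\mathscr J$-class is a $\mathscr D$-class. $\mathrm{NSub}(\Gamma)$ is the lattice of normal subgroups of $\Gamma$. *)

(* Defs.v *)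
From HB Require Import structures.
From mathcomp Require Import all_boot order.
From mathcomp Require Import boolp classical_sets functions cardinality.

Set Implicit Arguments.
Unset Strict Implicit.
Unset Printing Implicit Defensive.

Local Open Scope classical_set_scope.
Local Open Scope card_scope.
Local Open Scope group_scope.

(* Cardinals are well-ordered: every nonempty family has a least one. *)
Lemma card_min (I : Type) (i0 : I) (X : I -> Type) :
  exists i, forall j, exists f : X i -> X j, injective f.
Proof.
pose P (F : set (forall i, X i)) :=
  forall x y, F x -> F y -> x <> y -> forall i, x i <> y i.
have [F [PF Fmax]] : exists A, P A /\ forall B, A `<` B -> ~ P B.
  apply: Zorn_bigcup => G GP tot x y [A GA Ax] [B GB By].
  have [AB|BA] := tot A B GA GB; first exact: (GP B GB) (AB _ Ax) By.
  exact: (GP A GA) Ax (BA _ By).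
have [[i surj]|nsurj] := pselect (exists i, forall a, exists2 x, F x & x i = a).
  have {}surj a : exists x, F x /\ x i = a by have [x] := surj a; exists x.
  have [g gP] := boolp.choice surj.
  exists i => j; exists (fun a => g a j) => a b /= gab.
  have [Fa ga] := gP a; have [Fb gb] := gP b.
  have [gE|gN] := pselect (g a = g b); first by rewrite -ga -gb gE.
  by case: (PF _ _ Fa Fb gN j).
have /(_ _)/cid-/all_sig[x xP] i : exists a : X i, forall y, F y -> y i <> a.
  apply: contrapT => /forallNP H; apply: nsurj; exists i => a.
  apply: contrapT => Ha; apply: (H a) => y Fy ya; apply: Ha; by exists y.
case: (Fmax (F `|` [set x])).
  split=> [|sub]; first exact: subsetUl.
  by apply: (xP i0 x) => //; apply: sub; right.
move=> y z [Fy|->] [Fz|->] yz i //; first exact: PF.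
- exact: xP.
- by move=> /esym; exact: xP.
Qed.

Section Height.
Context d (T : porderType d).
Implicit Types (P C K : set T).

Definition chain_in P C :=
  C `<=` P /\ total_on C (fun x y => is_true (x <= y)%O).

Definition chain_bound P (U : Type) (K : set U) :=
  forall C, chain_in P C -> C #<= K.

Lemma card_le_inj (U V : Type) (A : set U) (B : set V) (f : A -> B) :
  injective f -> A #<= B.
Proof.
by move=> fi; apply/asboolP/injfunPex; exists f => // x y _ _; exact: fi.
Qed.

Lemma Ht_subproof P :
  {K : set T | chain_bound P K /\
    forall (U : Type) (B : set U), chain_bound P B -> K #<= B}.
Proof.
apply: cid.
have ubT : chain_bound P [set: T] by move=> C _; exact: card_leT.
have [[K ubK] Kmin] := card_min (exist (@chain_bound P T) _ ubT)
  (fun i => set_type (sval i)).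
exists K; split => // U B ubB.
have {}Kmin K' : chain_bound P K' -> K #<= K'.
  by move=> ubK'; have [f /card_le_inj] := Kmin (exist _ K' ubK').
have [[] minb] := card_min true
  (fun b : bool => if b then set_type B else set_type [set: T]).
  have [f fi] := minb false.
  have /card_eqPle[le ge] : range (fun x : B => val (f x)) #= B.
    by rewrite (card_eql (inj_card_eq _)) // => x y _ _ /val_inj /fi.
  have ubr : chain_bound P (range (fun x : B => val (f x))).
    by move=> C /ubB CB; exact: (card_le_trans CB ge).
  exact: (card_le_trans (Kmin _ ubr) le).
have [f /card_le_inj TB] := minb true.
exact: (card_le_trans (card_leT K) TB).
Qed.

(* A set whose cardinal is the supremum of the cardinals of the chains of the
   subposet P. *)
Definition Ht P : set T := proj1_sig (Ht_subproof P).

End Height.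

Section Green.
Context {S : semigroupType}.
Implicit Types (x y : S) (u v : option S) (A B J L R : set S).

(* S^1 as a set of elements of [option S]: [None] is the adjoined identity,
   present only when S has none. *)
Definition is_monoid := exists e : S, forall x, e * x = x /\ x * e = x.

Definition S1 : set (option S) := [set u | u = None -> ~ is_monoid].

Definition lact u x := if u is Some s then s * x else x.
Definition ract x u := if u is Some s then x * s else x.

Definition lideal x : set S := [set lact u x | u in S1].
Definition rideal x : set S := [set ract x u | u in S1].
Definition ideal x : set S :=
  [set y | exists u v, [/\ S1 u, S1 v & y = ract (lact u x) v]].

Definition Lrel x y := lideal x = lideal y.
Definition Rrel x y := rideal x = rideal y.
Definition Jrel x y := ideal x = ideal y.
Definition Hrel x y := Lrel x y /\ Rrel x y.

Definition Lclass x : set S := [set y | Lrel x y].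
Definition Rclass x : set S := [set y | Rrel x y].
Definition Jclass x : set S := [set y | Jrel x y].
Definition Hclass x : set S := [set y | Hrel x y].

Definition Jle A B := forall x y, A x -> B y -> ideal x `<=` ideal y.

Definition minimal_Jclass J :=
  range Jclass J /\ forall A, range Jclass A -> Jle A J -> A = J.

Definition stable_Jclass J := forall x u, J x -> S1 u ->
  (Jrel x (lact u x) -> Lrel x (lact u x)) /\
  (Jrel x (ract x u) -> Rrel x (ract x u)).

Definition Hseparable J := stable_Jclass J /\
  forall x y, J x -> J y -> ~ Hrel x y ->
    exists u v, [/\ S1 u, S1 v &
      J (ract (lact u x) v) /\ ~ J (ract (lact u y) v) \/
      ~ J (ract (lact u x) v) /\ J (ract (lact u y) v)].

End Green.
Arguments S1 : clear implicits.

Section GreenTheory.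
Context {S : semigroupType}.
Implicit Types (x y : S) (u v : option S).

Lemma S1_id : exists2 u, S1 S u & forall x, lact u x = x /\ ract x u = x.
Proof.
have [[e eP]|nm] := pselect (@is_monoid S); first by exists (Some e).
by exists None.
Qed.

Definition S1mul u v : option S :=
  if u is Some a then Some (ract a v) else v.

Lemma S1mul_in u v : S1 S u -> S1 S v -> S1 S (S1mul u v).
Proof. by case: u. Qed.

Lemma lactM u v x : lact (S1mul u v) x = lact u (lact v x).
Proof. by case: u => [a|] //; case: v => [b|] //=; rewrite mulgA. Qed.

Lemma ractM u v x : ract x (S1mul u v) = ract (ract x u) v.
Proof. by case: u => [a|] //; case: v => [b|] //=; rewrite mulgA. Qed.

Lemma lractA u v x : ract (lact u x) v = lact u (ract x v).
Proof. by case: u => [a|] //; case: v => [b|] //=; rewrite mulgA. Qed.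

Lemma LrelP x y : Lrel x y <->
  (exists2 u, S1 S u & lact u x = y) /\ (exists2 u, S1 S u & lact u y = x).
Proof.
have [i iS iP] := S1_id.
have mem (z : S) : lideal z z by exists i => //; case: (iP z).
split=> [e|[[u uS uE] [v vS vE]]].
  by split; [have := mem y; rewrite -e | have := mem x; rewrite e].
apply/seteqP; split=> _ [w wS <-].
  by exists (S1mul w v); rewrite ?lactM ?vE //; exact: S1mul_in.
by exists (S1mul w u); rewrite ?lactM ?uE //; exact: S1mul_in.
Qed.

Lemma RrelP x y : Rrel x y <->
  (exists2 u, S1 S u & ract x u = y) /\ (exists2 u, S1 S u & ract y u = x).
Proof.
have [i iS iP] := S1_id.
have mem (z : S) : rideal z z by exists i => //; case: (iP z).
split=> [e|[[u uS uE] [v vS vE]]].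
  by split; [have := mem y; rewrite -e | have := mem x; rewrite e].
apply/seteqP; split=> _ [w wS <-].
  by exists (S1mul v w); rewrite ?ractM ?vE //; exact: S1mul_in.
by exists (S1mul u w); rewrite ?ractM ?uE //; exact: S1mul_in.
Qed.

Lemma Lrel_ract x y v : Lrel x y -> Lrel (ract x v) (ract y v).
Proof.
move=> /LrelP[[u uS <-] [w wS e]]; apply/LrelP; split.
  by exists u; rewrite // lractA.
by exists w; rewrite // -lractA e.
Qed.

(* Green's lemma. *)
Lemma translation_inverse (h : S) v : S1 S v ->
  (forall x, Hclass h x -> Hclass h (ract x v)) ->
  exists2 w, S1 S w & forall x, Hclass h x ->
    [/\ Hclass h (ract x w), ract (ract x v) w = x & ract (ract x w) v = x].
Proof.
move=> vS Hv; have Hh : Hclass h h by [].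
have [Lhv /RrelP[_ [w wS wE]]] := Hv _ Hh.
exists w => // x [Lx Rx].
have E1 : ract (ract x v) w = x.
  by have /LrelP[[u _ <-] _] := Lx; rewrite !lractA wE.
have E2 : ract (ract x w) v = x.
  have : Lrel (ract h v) x by exact: etrans (esym Lhv) Lx.
  by move=> /LrelP[[u _ <-] _]; rewrite !lractA wE.
split=> //; split.
  have := Lrel_ract w (etrans (esym Lhv) Lx : Lrel (ract h v) x).
  by rewrite wE.
apply: etrans Rx _; apply/RrelP; split; [by exists w | by exists v].
Qed.

End GreenTheory.

Definition stable (S : semigroupType) :=
  forall J, range (@Jclass S) J -> stable_Jclass J.

(* Relations are sets of pairs, ordered by inclusion. The congruences of the
   acts on L and R are meant for L and R closed under the action of S, as is
   the case inside a stable minimal J-class. *)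
Section Congruences.
Context {S : semigroupType}.
Implicit Types (A L R : set S) (sigma tau : set (S * S)).

Definition equivalence_on A sigma :=
  [/\ sigma `<=` A `*` A,
      forall x, A x -> sigma (x, x),
      forall x y, sigma (x, y) -> sigma (y, x) &
      forall x y z, sigma (x, y) -> sigma (y, z) -> sigma (x, z)].

Definition lcong L : set (set (S * S)) :=
  [set sigma | equivalence_on L sigma /\
    forall s a b, sigma (a, b) -> sigma (s * a, s * b)].

Definition rcong R : set (set (S * S)) :=
  [set sigma | equivalence_on R sigma /\
    forall s a b, sigma (a, b) -> sigma (a * s, b * s)].

Definition nabla A : set (S * S) := A `*` A.

Definition Hrestr A : set (S * S) := A `*` A `&` [set p | Hrel p.1 p.2].

(* C is the set of congruences of an act on A. *)
Definition maximal_cong A (C : set (set (S * S))) sigma :=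
  [/\ C sigma, sigma <> nabla A &
      forall tau, C tau -> ~ (sigma `<` tau /\ tau `<` nabla A)].

Definition unique_maximal_cong A (C : set (set (S * S))) sigma :=
  maximal_cong A C sigma /\
  forall tau, maximal_cong A C tau -> tau = sigma.

End Congruences.

Definition Cong (S : semigroupType) : set (set (S * S)) :=
  [set sigma | [/\ equivalence_on [set: S] sigma,
    forall s a b, sigma (a, b) -> sigma (s * a, s * b) &
    forall s a b, sigma (a, b) -> sigma (a * s, b * s)]].

Arguments Cong : clear implicits.

Definition NSub (G : groupType) : set (set G) :=
  [set N : set G | group_closed [in N] /\ forall x y, N x -> N (x ^ y)].
Arguments NSub : clear implicits.

(* The Schutzenberger group of the H-class of h: the product is composition,
   and any H-class is obtained by choosing h in it. *)
Section Schutzenberger.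
Context {S : semigroupType} (h : S).

Definition is_translation (f : Hclass h -> Hclass h) :=
  exists2 t, S1 S t & forall x, val (f x) = ract (val x) t.

Definition schutzenberger := {f : Hclass h -> Hclass h | is_translation f}.

HB.instance Definition _ := gen_eqMixin schutzenberger.
HB.instance Definition _ := gen_choiceMixin schutzenberger.

Implicit Types f g : schutzenberger.

Lemma translation_id : is_translation id.
Proof. by have [i iS iP] := @S1_id S; exists i => // x; case: (iP (val x)). Qed.

Lemma translation_comp (f g : Hclass h -> Hclass h) :
  is_translation f -> is_translation g -> is_translation (f \o g).
Proof.
move=> [u uS uE] [v vS vE]; exists (S1mul v u); first exact: S1mul_in.
by move=> x; rewrite ractM -vE -uE.
Qed.

Lemma schutzenberger_inv_subproof f :
  {g : schutzenberger |
    cancel (sval f) (sval g) /\ cancel (sval g) (sval f)}.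
Proof.
apply: cid; case: f => f [u uS uE] /=.
have Hu x : Hclass h x -> Hclass h (ract x u).
  by move=> Hx; have := valP (f (SigSub (mem_set Hx))); rewrite uE => /set_mem.
have [v vS vP] := translation_inverse uS Hu.
have Hv (x : Hclass h) : ract (val x) v \in Hclass h.
  by apply/mem_set; case: (vP _ (set_mem (valP x))).
pose g (x : Hclass h) : Hclass h := SigSub (Hv x).
have gP : is_translation g by exists v.
exists (exist _ g gP); split=> x; apply: val_inj; rewrite /= ?uE /=.
  by case: (vP _ (set_mem (valP x))).
by case: (vP _ (set_mem (valP x))).
Qed.

Definition schutzenberger_one : schutzenberger := exist _ _ translation_id.
Definition schutzenberger_mul f g : schutzenberger :=
  exist _ _ (translation_comp (svalP f) (svalP g)).
Definition schutzenberger_inv f : schutzenberger :=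
  sval (schutzenberger_inv_subproof f).

Lemma schutzenbergerP f g : sval f =1 sval g -> f = g.
Proof.
by case: f g => f fP [g gP] /= fg; apply: eq_exist; apply/funext.
Qed.

Lemma schutzenberger_mulA : associative schutzenberger_mul.
Proof. by move=> f g k; exact: schutzenbergerP. Qed.

Lemma schutzenberger_mul1 : left_id schutzenberger_one schutzenberger_mul.
Proof. by move=> f; exact: schutzenbergerP. Qed.

Lemma schutzenberger_1mul : right_id schutzenberger_one schutzenberger_mul.
Proof. by move=> f; exact: schutzenbergerP. Qed.

Lemma schutzenberger_mulV :
  left_inverse schutzenberger_one schutzenberger_inv schutzenberger_mul.
Proof.
move=> f; apply: schutzenbergerP.
by case: (svalP (schutzenberger_inv_subproof f)).
Qed.

Lemma schutzenberger_Vmul :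
  right_inverse schutzenberger_one schutzenberger_inv schutzenberger_mul.
Proof.
move=> f; apply: schutzenbergerP.
by case: (svalP (schutzenberger_inv_subproof f)).
Qed.

HB.instance Definition _ := isGroup.Build schutzenberger
  schutzenberger_mulA schutzenberger_mul1 schutzenberger_1mul
  schutzenberger_mulV schutzenberger_Vmul.

End Schutzenberger.

(* Main.v *)
Require Import Defs.
From mathcomp Require Import all_boot order.
From mathcomp Require Import boolp classical_sets functions cardinality.

Set Implicit Arguments.
Unset Strict Implicit.
Unset Printing Implicit Defensive.

Local Open Scope classical_set_scope.
Local Open Scope card_scope.

(** Let [h r] represent the J-class [J_r], and let [Gamma_r] be the
    Schutzenberger group of its H-class.  A congruence [sigma] leaves a trace in
    every [Gamma_r]: the normal subgroup of the translations [f] such that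
    [sigma] relates [h r] to its image under [f].  As [J_r] is stable, Green's
    lemma carries any pair of H-related elements of [J_r] to a pair inside the
    H-class of [h r], so the trace determines the part of [sigma] that lies in
    [J_r] and inside H ([trace_le]).

    Upper bound.  Refine the J-order to a linear order of the finitely many
    J-classes, given by a rank [rho].  Say that [sigma] descends at [J_r] if it
    relates some, and then every, element of [J_r] to an element of smaller
    rank.  Every element is related to one in whose class [sigma] does not
    descend ([descent]), and H-separability confines [sigma] to H in such a
    class, the minimal class excepted ([Hseparable_descends]): a pair of [sigma]
    outside H is multiplied into a pair of which just one member has left the
    class.  In the minimal class, if [sigma] is not contained in R, maximality
    of [H_L] forces every R-class to be met, inside each L-class, by each
    [sigma]-class ([Rrel_transversal]); dually for L.  Hence two comparable
    congruences are equal as soon as they descend at the same classes, have the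
    same traces where they do not descend, and agree on being contained in R,
    and in L, on the minimal class ([agree_all_sub]).

    All these data are monotone in [sigma].  An element of a chain is determined
    by the first coordinate up to which it is the last element with its values,
    together with its value there; and for the coordinates after the first, this
    value is not the last one in the chain, so that it is neither the value of
    descending nor the one of not being contained in R, or in L.  This injects
    the chain into the disjoint union of its traces and of at most two further
    points ([chain_labels], [Cong_chain_bound]), whether it is finite or not.

    Lower bound.  A normal subgroup [N] of [Gamma_r] gives a congruence
    [extension N] with trace [N], which lies in H on [J_r], is universal on the
    ideal of elements of rank below that of [J_r], and is trivial elsewhere.
    Chains of normal subgroups, one for each [r], are put on top of each other
    in the order of the ranks; between those of the minimal class and the
    following ones there is room for R on the minimal class if L-classes and
    R-classes both differ from H-classes there, and for the universal relation
    on the minimal class if there is more than one H-class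
    ([Cong_chain_exists]).

    Suprema.  A finite height is attained by a chain, so the lower bound is
    then the sum of the heights.  If some height is infinite, each summand
    still embeds in the height of the lattice of congruences, and finitely many
    copies of an infinite set embed in it ([Ht_sum_le]). *)

(** * Cardinals and heights *)

Lemma card_leEx (U V : Type) (A : set U) (B : set V) :
  A #<= B <-> exists f : A -> B, injective f.
Proof.
split=> [/card_leP|[f /card_le_inj //]].
move=> /injfunPex[f _ fi]; exists f => x y; apply: fi; exact: mem_set.
Qed.

(** A maximal family of disjoint injective sequences in [K] leaves out only
    finitely many elements, so [K] is a product with [nat] up to these. *)
Lemma infinite_mul_nat_inj (U : Type) (K : set U) :
  infinite_set K -> exists g : K * nat -> K, injective g.
Proof.
move=> /infiniteP/card_leEx[i0 i0_inj].
pose D (F : set (nat -> K)) :=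
  (forall f, F f -> injective f) /\
  (forall f g m n, F f -> F g -> f m = g n -> f = g).
have [F [[Finj Fdisj] Fmax]] : exists F, D F /\ forall G, F `<` G -> ~ D G.
  apply: Zorn_bigcup => FF FD tot; split.
    by move=> f [X /FD[Xi _] Xf]; exact: Xi.
  move=> f g m n [X FX Xf] [Y FY Yg].
  have [XY|YX] := tot X Y FX FY.
    by case: (FD _ FY) => _; apply=> //; exact: XY.
  by case: (FD _ FX) => _; apply=> //; exact: YX.
pose rest := [set x : K | forall f n, F f -> f n <> x].
have rest_fin : finite_set rest.
  apply: contrapT => /infiniteP/card_leEx[e e_inj].
  pose e0 n : K := val (e (exist _ n (mem_set I))).
  have e0_inj : injective e0 by move=> m n /val_inj /e_inj [].
  have e0_rest n : rest (e0 n) by exact: (set_mem (valP (e _))).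
  have Fe0 : ~ F e0 by move=> /(e0_rest 0) - /(_ 0) /(_ erefl).
  apply: (Fmax (F `|` [set e0])).
    split=> [|sub]; first exact: subsetUl.
    by apply: Fe0; apply: sub; right.
  split=> [f [/Finj//|->//]|f g m n [Ff|->] [Fg|->] //].
  - exact: Fdisj.
  - by move=> E; case: (e0_rest n f m Ff).
  - by move=> /esym E; case: (e0_rest m g n Fg).
have [x0 Fx0] : F !=set0.
  apply: contrapT => F0; apply: infinite_nat.
  have : finite_set (range (fun n => i0 (exist _ n (mem_set I)))).
    apply: (sub_finite_set _ rest_fin) => _ [n _ <-] f m Ff _.
    by apply: F0; exists f.
  by rewrite (eq_finite_set (inj_card_eq _)) // => x y _ _ /i0_inj [].
have [e e_inj] : exists e : K -> nat, forall x y, rest x -> rest y ->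
    e x = e y -> x = y.
  have /card_leEx[e e_inj] := finite_set_countable rest_fin.
  exists (fun x => if pselect (rest x) is left rx
                   then val (e (exist _ x (mem_set rx))) else 0).
  move=> x y rx ry; case: pselect => // rx'; case: pselect => // ry'.
  by move=> /val_inj /e_inj [].
(* The tag 1 marks the elements on a sequence; those left out share the
   sequence [x0], under the tag 0. *)
have /boolp.choice[c cP] k : exists c : (nat -> K) * (nat * nat), F c.1 /\
    (c.2.1 = 1 /\ c.1 c.2.2 = k \/ [/\ c.2.1 = 0, c.2.2 = e k & rest k]).
  have [[f [n [Ff fn]]]|nk] := pselect (exists f n, F f /\ f n = k).
    by exists (f, (1, n)); split=> //; left.
  exists (x0, (0, e k)); split=> //; right; split=> // f n Ff fn.
  by apply: nk; exists f, n.
exists (fun p => (c p.1).1 (pickle ((c p.1).2, p.2))) => -[k m] [k' m'] /= E.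
have [[F1 P1] [F2 P2]] := (cP k, cP k').
have fE := Fdisj _ _ _ _ F1 F2 E.
move: E; rewrite -fE => /(Finj _ F1)/(pcan_inj pickleK)[cE ->].
congr pair; case: P1 => [[c1 <-]|[c1 c2 rk]]; case: P2 => [[d1 <-]|[d1 d2 rk']].
- by rewrite fE cE.
- by move: d1; rewrite -cE c1.
- by move: d1; rewrite -cE c1.
- by apply: e_inj => //; rewrite -c2 cE.
Qed.

Section HeightBound.
Context d (T : porderType d).
Implicit Types (P C : set T).

Lemma chain_in0 P : chain_in P set0.
Proof. by split. Qed.

Lemma chain_bound_Ht P : chain_bound P (Ht P).
Proof. by have [] := proj2_sig (Ht_subproof P). Qed.

Lemma Ht_le P (U : Type) (B : set U) : chain_bound P B -> Ht P #<= B.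
Proof. by have [_] := proj2_sig (Ht_subproof P); exact. Qed.

(** If no chain reached a finite height, its predecessor would still bound all
    of them. *)
Lemma finite_Ht_attained P : finite_set (Ht P) ->
  exists2 C, chain_in P C & Ht P #<= C.
Proof.
move=> Hfin; apply: contrapT => noC.
have [m Hm] := Hfin.
have Cle C : chain_in P C -> C #<= `I_m.-1.
  move=> CP; have CH := chain_bound_Ht CP.
  have [k Ck] := card_le_finite CH Hfin.
  rewrite (card_le_eql Ck) card_le_II.
  have : ~ (Ht P #<= C) by move=> HC; apply: noC; exists C.
  rewrite (card_le_eql Hm) (card_le_eqr Ck) card_le_II => /negP.
  by rewrite -ltnNge; case: (m).
have := Ht_le Cle; rewrite (card_le_eql Hm) card_le_II.
case: m Hm {Cle} => [Hm _|m _]; last by rewrite ltnn.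
apply: noC; exists set0; first exact: chain_in0.
by rewrite (card_le_eql Hm) II0 card_ge0.
Qed.
End HeightBound.
Lemma existT_inj (I : eqType) (X : I -> Type) i (x y : X i) :
  existT X i x = existT X i y -> x = y.
Proof. by move=> /(congr1 (tagged_as (Tagged X x))); rewrite !tagged_asE. Qed.

Lemma sigma_sum_inj (I : eqType) (X Y : I -> Type) (E : Type) :
  (forall i, exists f : X i -> Y i, injective f) ->
  exists f : {i & X i} + E -> {i & Y i} + E, injective f.
Proof.
move=> H.
have f i : {f : X i -> Y i | injective f} by exact: cid (H i).
exists (fun s => match s with
  | inl p => inl (existT Y (projT1 p) (sval (f _) (projT2 p)))
  | inr e => inr e end).
move=> [[i x]|e] [[j y]|e'] //= [] => [|-> //].
move=> ij; move: y; rewrite -ij => y /(@existT_inj I Y).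
by move=> /(svalP (f i)) ->.
Qed.

(** Sums of heights are suprema of sums of chains. This is clear if the heights
    are attained; otherwise [K] is infinite and absorbs the sum. *)
Lemma Ht_sum_le (I : countType) (d : I -> Order.disp_t)
    (T : forall i, porderType (d i)) (P : forall i, set (T i)) (E : Type)
    (U : Type) (K : set U) (e : E -> nat) : injective e ->
  (forall C : forall i, set (T i), (forall i, chain_in (P i) (C i)) ->
     exists f : {i & C i} + E -> K, injective f) ->
  exists f : {i & Ht (P i)} + E -> K, injective f.
Proof.
move=> e_inj CK.
have [Hfin|/existsNP[i0 Hinf]] := pselect (forall i, finite_set (Ht (P i))).
  have C i := cid2 (finite_Ht_attained (Hfin i)).
  have [f f_inj] := CK (fun i => s2val (C i)) (fun i => s2valP (C i)).
  have [g g_inj] : exists g : {i & Ht (P i)} + E -> {i & s2val (C i)} + E,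
      injective g.
    by apply: sigma_sum_inj => i; exact/card_leEx/(s2valP' (C i)).
  by exists (f \o g); exact: inj_comp.
have HtK i : exists f : Ht (P i) -> K, injective f.
  apply/card_leEx/Ht_le => D PD; apply/card_leEx.
  (* A chain of one of the posets is a family of chains, the others empty. *)
  pose C j := [set x : T j |
    exists2 y, D y & existT (fun j => T j : Type) j x = existT _ i y].
  have CP j : chain_in (P j) (C j).
    have [<-|ij] := eqVneq i j; last first.
      by split=> [x [y _ /(congr1 tag)/= ji]|x x' [y _ /(congr1 tag)/= ji]];
        rewrite ji eqxx in ij.
    have CD x : C i x -> D x.
      by move=> [y Dy /(@existT_inj I (fun j => T j)) ->].
    case: PD => DP Dtot; split=> [x /CD|x x' /CD Dx /CD Dx']; first exact: DP.
    exact: Dtot.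
  have [f f_inj] := CK C CP.
  have DC (x : D) : C i (val x).
    by exists (val x) => //; exact: set_mem (valP x).
  exists (fun x => f (inl (existT _ i (exist _ (val x) (mem_set (DC x)))))).
  by move=> x y /f_inj[] /(@existT_inj I (fun j => T j))/val_inj.
have Kinf : infinite_set K.
  move=> Kfin; apply: Hinf; have /card_leEx HK := HtK i0.
  exact: card_le_finite HK Kfin.
have [g g_inj] := infinite_mul_nat_inj Kinf.
have [k Kk] := infinite_setN0 Kinf.
pose k0 : K := exist _ k (mem_set Kk).
have F i := cid (HtK i).
exists (fun s => match s with
  | inl p => g (sval (F _) (projT2 p), (pickle (projT1 p)).*2)
  | inr x => g (k0, (e x).*2.+1) end).
move=> [[i x]|x] [[j y]|y] /= /g_inj [].
- move=> + /double_inj/(pcan_inj pickleK) ij; move: y; rewrite -ij => y.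
  by move=> /(svalP (F i)) ->.
- by move=> _ /(congr1 odd); rewrite /= !odd_double.
- by move=> _ /(congr1 odd); rewrite /= !odd_double.
- by move=> /double_inj/e_inj ->.
Qed.

(** For monotone maps that jointly separate the elements of a chain, [E i] means
    the equality of the values of the i-th map; relations avoid maps into
    different posets. Convexity is what remains of monotonicity. *)
Section ChainLabels.
Context d (T : porderType d) (C : set T) (m : nat) (E : nat -> T -> T -> Prop).
Hypothesis C_total : total_on C (fun x y => is_true (x <= y)%O).
Hypothesis E_sym : forall i x y, E i x y -> E i y x.
Hypothesis E_convex : forall i x y z, (x <= y)%O -> (y <= z)%O ->
  E i x z -> E i x y.
Hypothesis E_sep : forall x y, C x -> C y ->
  (forall i, i < m.+1 -> E i x y) -> x = y.

(** The label of [x] is the least [i] for which [x] is the last element with its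
    values at the coordinates up to [i]. Together with the value at this
    coordinate the label determines [x]; and for [i > 0] this value is not the
    last one in the chain, as [x] is not yet the last element with its values
    before [i]. *)
Lemma chain_labels : exists lab : T -> nat, [/\
  forall x, C x -> lab x < m.+1,
  forall x, C x -> lab x = 0 \/
    exists y, [/\ C y, (x < y)%O & ~ E (lab x) x y] &
  forall x y, C x -> C y -> lab x = lab y -> E (lab x) x y -> x = y].
Proof.
pose top x i := forall y, C y -> (x < y)%O -> ~ (forall j, j <= i -> E j x y).
have topm x : C x -> top x m.
  move=> Cx y Cy xy Exy.
  by have := xy; rewrite (E_sep Cx Cy) ?Order.POrderTheory.ltxx.
have /boolp.choice[lab labP] x : exists i, C x ->
    [/\ i < m.+1, top x i & i = 0 \/ ~ top x i.-1].
  have [Cx|nCx] := pselect (C x); last by exists 0.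
  have ex : exists i, `[< top x i >] by exists m; exact/asboolP/topm.
  exists (ex_minn ex); case: ex_minnP => i /asboolP xi imin _; split=> //.
    by rewrite ltnS; apply: imin; exact/asboolP/topm.
  case: i xi imin => [|i] _ imin; [by left | right => /asboolP /imin].
  by rewrite ltnn.
exists lab; split=> [x /labP[]//|x Cx|].
  have [_ xtop [->|xN]] := labP x Cx; [by left | right].
  apply: contrapT => nE; apply: xN => y Cy xy Exy; apply: (xtop y Cy xy) => j.
  rewrite leq_eqVlt => /orP[/eqP->|jl].
    by apply: contrapT => nExy; apply: nE; exists y.
  by apply: Exy; case: (lab x) jl.
move=> x y Cx Cy.
wlog xy : x y Cx Cy / (x <= y)%O.
  move=> H l Exy; case: (C_total Cx Cy) => xy; first exact: H.
  by apply/esym/(H y x) => //; rewrite -l; exact: E_sym.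
move=> l Exy; apply: contrapT => /eqP nxy.
have ltxy : (x < y)%O by rewrite Order.POrderTheory.lt_def eq_sym nxy.
have [_ xtop xmin] := labP x Cx; have [_ ytop ymin] := labP y Cy.
apply: (xtop y Cy ltxy) => j; rewrite leq_eqVlt => /orP[/eqP-> //|jl].
case: xmin => [l0|]; first by rewrite l0 in jl.
move=> /existsNP[z] /not_implyP[Cz] /not_implyP[xz] /contrapT Exz.
(* If [z] comes after [y], then by convexity [y] agrees with [x] wherever [z]
   does. Otherwise [z] is between [x] and [y] and agrees with [x] at the label
   too, where [x] should be the last to have its values. *)
have Ejz : E j x z by apply: Exz; case: (lab x) jl.
have [yz|zy] := C_total Cy Cz; first exact: (E_convex xy yz).
case: (xtop z Cz xz) => k; rewrite leq_eqVlt => /orP[/eqP->|kl].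
  by apply: E_convex zy _ => //; exact: Order.POrderTheory.ltW.
by apply: Exz; case: (lab x) kl.
Qed.
End ChainLabels.

(** * Stable J-classes *)

Section GreenRelations.
Local Open Scope group_scope.
Context {S : semigroupType}.
Implicit Types (a b h x y z : S) (u v w : option S).

Lemma ideal_refl x : ideal x x.
Proof.
have [i iS iP] := @S1_id S; exists i, i; split=> //.
by have [-> _] := iP x; have [_ ->] := iP x.
Qed.

Lemma ideal_trans x y z : ideal x y -> ideal y z -> ideal x z.
Proof.
move=> [u [v [uS vS ->]]] [u' [v' [uS' vS' ->]]].
exists (S1mul u' u), (S1mul v v'); split; try exact: S1mul_in.
by rewrite lactM ractM !lractA.
Qed.

Lemma idealS x y : (ideal x `<=` ideal y) <-> ideal y x.
Proof.
split=> [|yx z]; first by apply; exact: ideal_refl.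
exact: ideal_trans.
Qed.

Lemma ideal_biact u v x : S1 S u -> S1 S v -> ideal x (ract (lact u x) v).
Proof. by move=> uS vS; exists u, v. Qed.

Lemma ideal_lact u x : S1 S u -> ideal x (lact u x).
Proof.
move=> uS; have [i iS iP] := @S1_id S.
by have := ideal_biact x uS iS; have [_ ->] := iP (lact u x).
Qed.

Lemma ideal_ract u x : S1 S u -> ideal x (ract x u).
Proof.
move=> uS; have [i iS iP] := @S1_id S.
by have := ideal_biact x iS uS; have [-> _] := iP x.
Qed.

Lemma JrelP x y : Jrel x y <-> ideal x y /\ ideal y x.
Proof.
split=> [E|[xy yx]]; last by apply/seteqP; split; exact/idealS.
by split; [rewrite /Jrel in E; rewrite E | rewrite -E]; exact: ideal_refl.
Qed.

Lemma Lrel_Jrel x y : Lrel x y -> Jrel x y.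
Proof.
move=> /LrelP[[u uS <-] [v vS E]]; apply/JrelP; split; first exact: ideal_lact.
by rewrite -{2}E; exact: ideal_lact.
Qed.

Lemma Rrel_Jrel x y : Rrel x y -> Jrel x y.
Proof.
move=> /RrelP[[u uS <-] [v vS E]]; apply/JrelP; split; first exact: ideal_ract.
by rewrite -{2}E; exact: ideal_ract.
Qed.

Lemma Hrel_Jrel x y : Hrel x y -> Jrel x y.
Proof. by case=> /Lrel_Jrel. Qed.

Lemma Hrel_refl x : Hrel x x.
Proof. by []. Qed.

Lemma Hrel_sym x y : Hrel x y -> Hrel y x.
Proof. by case=> /esym ? /esym ?. Qed.

Lemma Hrel_trans x y z : Hrel x y -> Hrel y z -> Hrel x z.
Proof.
by move=> [l r] [l' r']; split; [apply: etrans l l' | apply: etrans r r'].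
Qed.

Lemma Rrel_lact x y u : Rrel x y -> Rrel (lact u x) (lact u y).
Proof.
move=> /RrelP[[v vS <-] [w wS e]]; apply/RrelP; split.
  by exists v; rewrite // lractA.
by exists w; rewrite // lractA e.
Qed.

Hypothesis St : stable S.

Lemma stable_lact x u : S1 S u -> Jrel x (lact u x) -> Lrel x (lact u x).
Proof. by move=> uS; have [] // := @St (Jclass x) _ x u erefl uS; exists x. Qed.

Lemma stable_ract x u : S1 S u -> Jrel x (ract x u) -> Rrel x (ract x u).
Proof. by move=> uS; have [] // := @St (Jclass x) _ x u erefl uS; exists x. Qed.

Lemma stable_biact x u v : S1 S u -> S1 S v -> Jrel x (ract (lact u x) v) ->
  [/\ Lrel x (lact u x), Rrel (lact u x) (ract (lact u x) v),
      Rrel x (ract x v) & Lrel (ract x v) (ract (lact u x) v)].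
Proof.
move=> uS vS xuv.
have Jl : Jrel x (lact u x).
  apply/JrelP; split; first exact: ideal_lact.
  by apply: (@ideal_trans _ (ract (lact u x) v));
    [exact: ideal_ract | case/JrelP: xuv].
have Jr : Jrel x (ract x v).
  apply/JrelP; split; first exact: ideal_ract.
  by apply: (@ideal_trans _ (ract (lact u x) v));
    [rewrite lractA; exact: ideal_lact | case/JrelP: xuv].
split; [exact: stable_lact | | exact: stable_ract |].
  by apply: stable_ract => //; exact: etrans (esym Jl) xuv.
rewrite lractA; apply: stable_lact => //; rewrite -lractA.
exact: etrans (esym Jr) xuv.
Qed.

(** R is a left congruence, and stability keeps [lact u x] and [lact u y] in the
    common L-class of [x] and [y]. *)
Lemma Hrel_lact x y u : S1 S u -> Hrel x y -> Jrel x (lact u x) ->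
  Hrel (lact u x) (lact u y).
Proof.
move=> uS [Lxy Rxy] Jx; have Ruxy := Rrel_lact u Rxy; split=> //.
have Jy : Jrel y (lact u y).
  apply: etrans (esym (Lrel_Jrel Lxy)) _.
  exact: etrans Jx (Rrel_Jrel Ruxy).
apply: etrans (esym (stable_lact uS Jx)) _.
exact: etrans Lxy (stable_lact uS Jy).
Qed.

Lemma Hrel_ract x y u : S1 S u -> Hrel x y -> Jrel x (ract x u) ->
  Hrel (ract x u) (ract y u).
Proof.
move=> uS [Lxy Rxy] Jx; have Luxy := Lrel_ract u Lxy; split=> //.
have Jy : Jrel y (ract y u).
  apply: etrans (esym (Lrel_Jrel Lxy)) _.
  exact: etrans Jx (Lrel_Jrel Luxy).
apply: etrans (esym (stable_ract uS Jx)) _.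
exact: etrans Rxy (stable_ract uS Jy).
Qed.

Lemma Hrel_biact x y u v : S1 S u -> S1 S v -> Hrel x y ->
  Jrel x (ract (lact u x) v) -> Hrel (ract (lact u x) v) (ract (lact u y) v).
Proof.
move=> uS vS Hxy /(stable_biact uS vS)[Lx Rx _ _].
apply: Hrel_ract => //; last exact: Rrel_Jrel.
by apply: Hrel_lact => //; exact: Lrel_Jrel.
Qed.

(** Green's lemma, two-sided: in a stable J-class, multiplication on both sides
    carries H-classes bijectively to H-classes, and a multiplication inverts
    it. *)
Lemma biact_inverse h u v : S1 S u -> S1 S v -> Jrel h (ract (lact u h) v) ->
  exists p q, [/\ S1 S p, S1 S q,
    forall x, Hrel h x -> ract (lact p (ract (lact u x) v)) q = x,
    forall b, Hrel (ract (lact u h) v) b ->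
      ract (lact u (ract (lact p b) q)) v = b &
    forall b, Hrel (ract (lact u h) v) b -> Hrel h (ract (lact p b) q)].
Proof.
move=> uS vS Juv; have [Lh Rh _ _] := stable_biact uS vS Juv.
have /LrelP[_ [p pS pE]] := Lh; have /RrelP[_ [q qS qE]] := Rh.
have inv x : Hrel h x -> ract (lact p (ract (lact u x) v)) q = x.
  move=> Hx; have [/LrelP[[z _ zE] _] _] := Hrel_lact uS Hx (Lrel_Jrel Lh).
  have -> : ract (lact p (ract (lact u x) v)) q = lact p (lact u x).
    by rewrite lractA -zE; congr lact; rewrite !(lractA z) qE.
  by have [_ /RrelP[[w _ <-] _]] := Hx; rewrite -!lractA pE.
exists p, q; split=> // b Hb.
- have -> : ract (lact u (ract (lact p b) q)) v
      = lact u (lact p (ract (ract b q) v)) by rewrite !lractA.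
  have -> : ract (ract b q) v = b.
    have [/LrelP[[z _ <-] _] _] := Hb.
    by rewrite (lractA z) qE lractA.
  have [_ /RrelP[[w _ <-] _]] := Hb.
  by rewrite -!lractA pE.
- have hE := inv h (Hrel_refl h).
  by have := Hrel_biact pS qS Hb; rewrite hE; apply; exact: esym.
Qed.

End GreenRelations.

(** * Translations of an H-class *)

Section Translations.
Local Open Scope group_scope.
Context {S : semigroupType} (h : S).
Implicit Types (x y : S) (f g : schutzenberger h) (sigma : set (S * S)).

(** A multiplier inducing [f]; with it translations act on elements of [S]
    rather than on the subtype of the H-class. *)
Definition tr f : option S := s2val (cid2 (svalP f)).

Let pt x (Hx : Hrel h x) : Hclass h := exist _ x (mem_set Hx).

Lemma trE f x (Hx : Hrel h x) : val (sval f (pt Hx)) = ract x (tr f).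
Proof. by rewrite /tr; case: cid2 => t /= _ ->. Qed.

Lemma tr_H f x : Hrel h x -> Hrel h (ract x (tr f)).
Proof. by move=> Hx; rewrite -(trE f Hx); exact: set_mem (valP (sval f _)). Qed.

Lemma trM f g x : Hrel h x -> ract x (tr (f * g)) = ract (ract x (tr g)) (tr f).
Proof.
move=> Hx; rewrite -(trE _ Hx) -(trE f (tr_H g Hx)) /=; congr (val (sval f _)).
by apply: val_inj; rewrite /= -(trE g Hx).
Qed.

Lemma tr1 x : Hrel h x -> ract x (tr 1) = x.
Proof. by move=> Hx; rewrite -(trE _ Hx). Qed.

Lemma trV f x : Hrel h x -> ract (ract x (tr f)) (tr f^-1) = x.
Proof. by move=> Hx; rewrite -trM // mulVg tr1. Qed.

(** Elements of the H-class are left multiples of [h], and translations commute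
    with left multiplications. *)
Lemma tr_inj f g : ract h (tr f) = ract h (tr g) -> f = g.
Proof.
move=> E; apply: schutzenbergerP => -[x xH].
have Hx : Hrel h x := set_mem xH.
have -> : exist _ x xH = pt Hx by exact: val_inj.
apply: val_inj; rewrite /= !trE.
by have [/LrelP[[z _ <-] _] _] := Hx; rewrite !lractA E.
Qed.

Lemma tr_of_S1 t : S1 S t -> Hrel h (ract h t) ->
  exists f, forall x, Hrel h x -> ract x (tr f) = ract x t.
Proof.
move=> tS [Lt Rt].
have Ht x : Hrel h x -> Hrel h (ract x t).
  move=> [Lx Rx]; split; first by apply: etrans Lt _; exact: Lrel_ract.
  apply: etrans Rx _; have /LrelP[[z _ <-] _] := Lx.
  by rewrite lractA; exact: Rrel_lact.
pose k (x : Hclass h) : Hclass h :=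
  exist _ (ract (val x) t) (mem_set (Ht _ (set_mem (valP x)))).
have kP : is_translation k by exists t.
by exists (exist _ k kP) => x Hx; rewrite -(trE _ Hx).
Qed.

Lemma tr_transitive x : Hrel h x -> exists f, ract h (tr f) = x.
Proof.
move=> Hx; have [_ /RrelP[[t tS tE] _]] := Hx.
have [|f fE] := tr_of_S1 tS; first by rewrite tE.
by exists f; rewrite fE.
Qed.

End Translations.

(** * Traces of congruences, and congruences with a given trace *)

Section Traces.
Local Open Scope group_scope.
Context {S : semigroupType}.
Implicit Types (a b h x y z : S) (u v w : option S) (sigma tau : set (S * S)).

Lemma Cong_refl sigma x : Cong S sigma -> sigma (x, x).
Proof. by case=> -[_ r _ _] _ _; exact: r. Qed.

Lemma Cong_sym sigma x y : Cong S sigma -> sigma (x, y) -> sigma (y, x).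
Proof. by case=> -[_ _ s _] _ _; exact: s. Qed.

Lemma Cong_trans sigma y x z : Cong S sigma ->
  sigma (x, y) -> sigma (y, z) -> sigma (x, z).
Proof. by case=> -[_ _ _ t] _ _; exact: t. Qed.

Lemma Cong_lact sigma u x y : Cong S sigma ->
  sigma (x, y) -> sigma (lact u x, lact u y).
Proof. by case: u => // s [_ l _]; exact: l. Qed.

Lemma Cong_ract sigma u x y : Cong S sigma ->
  sigma (x, y) -> sigma (ract x u, ract y u).
Proof. by case: u => // s [_ _ r]; exact: r. Qed.

Definition trace h sigma : set (schutzenberger h) :=
  [set f | sigma (h, ract h (tr f))].
Arguments trace : clear implicits.

Lemma traceP h sigma (f : schutzenberger h) x : Cong S sigma ->
  trace h sigma f -> Hrel h x -> sigma (x, ract x (tr f)).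
Proof.
move=> cs fN [/LrelP[[z _ <-] _] _].
by rewrite lractA; exact: Cong_lact.
Qed.

Lemma trace_sub h sigma tau : sigma `<=` tau -> trace h sigma `<=` trace h tau.
Proof. by move=> st f; exact: st. Qed.

Lemma trace_NSub h sigma : Cong S sigma ->
  NSub (schutzenberger h) (trace h sigma).
Proof.
move=> cs; have Hh := Hrel_refl h; split; [split|].
- by rewrite inE /trace /= tr1 //; exact: Cong_refl.
- move=> f g; rewrite !inE => fN gN; rewrite /trace /= trM //.
  apply: (Cong_trans (y := ract h (tr g^-1))) => //.
    apply: Cong_sym => //; have := Cong_ract (tr g^-1) cs gN.
    by rewrite trV.
  by apply: traceP => //; exact: tr_H.
- move=> f g fN; rewrite /trace /= conjgE !trM //.
  have := Cong_ract (tr g^-1) cs (traceP cs fN (tr_H g Hh)).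
  by rewrite trV.
Qed.

Hypothesis St : stable S.

(** A pair of H-related elements of the J-class of [h] is moved into the H-class
    of [h] by a multiplication, and back by its inverse. *)
Lemma trace_le h sigma tau a b : Cong S sigma -> Cong S tau ->
  trace h tau `<=` trace h sigma -> Jrel h a -> Hrel a b ->
  tau (a, b) -> sigma (a, b).
Proof.
move=> cs ct ts /[dup] Jha /JrelP[[u [v [uS vS aE]]] _].
rewrite {}aE in Jha * => Hab tab.
have [p [q [pS qS inv vni Hpq]]] := biact_inverse St uS vS Jha.
have [f fE] := tr_transitive (Hpq b Hab).
rewrite -(vni b Hab) -fE.
apply: Cong_ract => //; apply: Cong_lact => //; apply: ts.
rewrite /trace /= fE.
rewrite -{1}(inv h (Hrel_refl h)).
by apply: Cong_ract => //; exact: Cong_lact.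
Qed.

(** Left factors commute with translations, and the right factor [v] acts on the
    H-class as a translation [t]; so [g] is a conjugate of [f] by [t]. *)
Lemma NSub_biact h (N : set (schutzenberger h)) f u v :
  NSub _ N -> N f -> S1 S u -> S1 S v -> Hrel h (ract (lact u h) v) ->
  exists2 g, N g & ract (lact u (ract h (tr f))) v
                     = ract (ract (lact u h) v) (tr g).
Proof.
move=> [_ NJ] Nf uS vS Huv.
have [Luh Ruh Rhv Lhv] := stable_biact St uS vS (Hrel_Jrel Huv).
have Hs : Hrel h (lact u h).
  by split=> //; have [_ r] := Huv; exact: etrans r (esym Ruh).
have Hv : Hrel h (ract h v).
  by split=> //; have [l _] := Huv; exact: etrans l (esym Lhv).
have [t tE] := tr_of_S1 vS Hv.
exists (f ^ t^-1); first exact: NJ.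
rewrite -lractA -(tE _ (tr_H _ Hs)) -(tE _ Hs) conjgE invgK.
have Hst : Hrel h (ract (lact u h) (tr t)) by exact: tr_H.
by rewrite !trM ?trV.
Qed.

(** [rho] stands for a linear extension of the order of the J-classes. *)
Context (rho : S -> nat).
Hypothesis rho_le : forall x y, ideal y x -> rho x <= rho y.
Hypothesis rho_J : forall x y, rho x = rho y -> Jrel x y.

Lemma rho_Jrel x y : Jrel x y -> rho x = rho y.
Proof.
by move=> /JrelP[xy yx]; apply/eqP; rewrite eqn_leq !rho_le.
Qed.

Lemma rho_lt x y : ideal y x -> ~ Jrel y x -> rho x < rho y.
Proof.
move=> yx nJ; rewrite ltn_neqAle rho_le // andbT; apply/eqP => /rho_J.
by move/esym.
Qed.

Definition rees k : set (S * S) :=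
  [set p | p.1 = p.2 \/ rho p.1 < k /\ rho p.2 < k].

(** On the J-class of [h], the pairs are required to fall into one orbit of [N]
    whenever a multiplication brings them into the H-class of [h]. Quantified
    over all multipliers, this condition is stable under multiplication by its
    form; normality of [N] makes the pairs in the H-class of [h] itself satisfy
    it ([trace_extension]). *)
Definition extension h (N : set (schutzenberger h)) : set (S * S) :=
  rees (rho h) `|` [set p | [/\ Jrel h p.1, Hrel p.1 p.2 &
    forall u v, S1 S u -> S1 S v -> Hrel h (ract (lact u p.1) v) ->
      exists2 f, N f & ract (lact u p.2) v
                         = ract (ract (lact u p.1) v) (tr f)]].

Lemma rees_lact k u x y : S1 S u -> rees k (x, y) ->
  rees k (lact u x, lact u y).
Proof.
move=> uS [/= ->|[/= xh yh]]; [by left | right=> /=]; split.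
  by apply: leq_ltn_trans xh; apply: rho_le; exact: ideal_lact.
by apply: leq_ltn_trans yh; apply: rho_le; exact: ideal_lact.
Qed.

Lemma rees_ract k u x y : S1 S u -> rees k (x, y) ->
  rees k (ract x u, ract y u).
Proof.
move=> uS [/= ->|[/= xh yh]]; [by left | right=> /=]; split.
  by apply: leq_ltn_trans xh; apply: rho_le; exact: ideal_ract.
by apply: leq_ltn_trans yh; apply: rho_le; exact: ideal_ract.
Qed.

Lemma rees_equivalence k : equivalence_on [set: S] (rees k).
Proof.
split=> // [x _|x y|x y z]; first by left.
  by move=> [/= ->|[/= ? ?]]; [left | right].
move=> [/= -> //|[/= xh yh]] [/= <-|[/= _ zh]]; by right.
Qed.

Lemma rees_Cong k : Cong S (rees k).
Proof.
split=> [|s x y|s x y]; first exact: rees_equivalence.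
  exact: (@rees_lact k (Some s)).
exact: (@rees_ract k (Some s)).
Qed.

Lemma extension_Cong h (N : set (schutzenberger h)) :
  NSub _ N -> Cong S (extension N).
Proof.
move=> NN; have [NG _] := NN; have [N1 ND] := NG.
have NM := group_closedM NG; have NV := group_closedV NG.
have [_ _ rsym rtr] := rees_equivalence (rho h).
split; first split.
- by [].
- by move=> x _; left; left.
- move=> x y [/rsym|[/= Jx Hxy fxy]]; [by left | right; split=> /=].
  + exact: etrans Jx (Hrel_Jrel Hxy).
  + exact: Hrel_sym.
  + move=> u v uS vS Huv.
    have Huv' : Hrel h (ract (lact u x) v).
      apply: (Hrel_trans Huv); apply: Hrel_biact => //; first exact: Hrel_sym.
      apply: etrans (Hrel_Jrel Huv).
      exact/esym/(etrans Jx (Hrel_Jrel Hxy)).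
    have [f fN ->] := fxy u v uS vS Huv'.
    exists f^-1; last by rewrite trV.
    by apply: set_mem; apply: NV; exact: mem_set.
- move=> x y z [xy|[/= Jx Hxy fxy]] [yz|[/= Jy Hyz fyz]].
  + by left; exact: rtr yz.
  + case: xy => /= [->|[_]]; first by right.
    by rewrite (rho_Jrel Jy) ltnn.
  + case: yz => /= [<-|[+ _]]; first by right.
    by rewrite -(rho_Jrel (Hrel_Jrel Hxy)) -(rho_Jrel Jx) ltnn.
  + right; split=> //=; first exact: Hrel_trans Hyz.
    move=> u v uS vS Huv; have [f fN fE] := fxy u v uS vS Huv.
    have [|g gN gE] := fyz u v uS vS; first by rewrite fE; exact: tr_H.
    exists (g * f); last by rewrite trM // -fE.
    by apply: set_mem; apply: NM; exact: mem_set.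
- move=> s x y [xy|[/= Jx Hxy fxy]]; first
    by left; exact: (@rees_lact (rho h) (Some s)).
  have sS : S1 S (Some s) by [].
  have [Jsx|nJ] := pselect (Jrel h (s * x)); last first.
    have xsh : rho (s * x) < rho h.
      apply: rho_lt => //; apply: (ideal_trans (y := x)).
        by have /JrelP[] := Jx.
      exact: (ideal_lact x sS).
    left; right=> /=; split=> //; rewrite -(rho_Jrel (x := s * x)) //.
    by apply: Rrel_Jrel; have [_ /(Rrel_lact (Some s))] := Hxy.
  right; split=> //=.
    by apply: (Hrel_lact St sS Hxy); exact: etrans (esym Jx) Jsx.
  move=> u v uS vS; have := fxy (S1mul u (Some s)) v (S1mul_in uS sS) vS.
  by rewrite !lactM.
- move=> s x y [xy|[/= Jx Hxy fxy]]; first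
    by left; exact: (@rees_ract (rho h) (Some s)).
  have sS : S1 S (Some s) by [].
  have [Jsx|nJ] := pselect (Jrel h (x * s)); last first.
    have xsh : rho (x * s) < rho h.
      apply: rho_lt => //; apply: (ideal_trans (y := x)).
        by have /JrelP[] := Jx.
      exact: (ideal_ract x sS).
    left; right=> /=; split=> //; rewrite -(rho_Jrel (x := x * s)) //.
    by apply: Lrel_Jrel; have [/(Lrel_ract (Some s))] := Hxy.
  right; split=> //=.
    by apply: (Hrel_ract St sS Hxy); exact: etrans (esym Jx) Jsx.
  move=> u v uS vS; have := fxy u (S1mul (Some s) v) uS (S1mul_in sS vS).
  by rewrite !ractM -!(lractA u (Some s)).
Qed.

Lemma trace_extension h (N : set (schutzenberger h)) :
  NSub _ N -> trace h (extension N) = N.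
Proof.
move=> NN; have Hh := Hrel_refl h; apply/seteqP; split=> f.
  have [i iS iP] := @S1_id S.
  case=> [[/= hf|[/=]]|[/= _ Hf fN]]; last 2 first.
  - by rewrite ltnn.
  - have [] := fN i i iS iS; have [-> ->] := iP h => // g gN.
    by have [-> ->] := iP (ract h (tr f)) => /tr_inj ->.
  have -> : f = 1 by apply: tr_inj; rewrite tr1.
  by have [[/set_mem]] := NN.
move=> fN; right; split=> //=; first exact: tr_H.
by move=> u v uS vS; exact: NSub_biact.
Qed.

Lemma extension_sub h (N M : set (schutzenberger h)) :
  N `<=` M -> extension N `<=` extension M.
Proof.
move=> NM p [r|[J H f]]; [by left | right; split=> // u v uS vS Huv].
by have [g /NM gM gE] := f u v uS vS Huv; exists g.
Qed.

Lemma rees_sub k l : k <= l -> rees k `<=` rees l.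
Proof.
move=> kl [x y] [/= ->|[/= xk yk]]; first by left.
by right; split; exact: leq_trans kl.
Qed.

Lemma extension_rees h (N : set (schutzenberger h)) :
  extension N `<=` rees (rho h).+1.
Proof.
move=> [x y] [|[/= Jx Hxy _]]; first exact: rees_sub.
by right; rewrite /= -(rho_Jrel (Hrel_Jrel Hxy)) -(rho_Jrel Jx).
Qed.

(** Between incomparable J-classes, [rho] decides which one can descend to the
    other. *)
Definition descends sigma h := exists x y,
  [/\ Jrel h x, sigma (x, y) & rho y < rho h].

(** Multiplication reaches every element of the J-class from any other and does
    not increase ranks. *)
Lemma descends_all sigma h x : Cong S sigma -> descends sigma h ->
  Jrel h x -> exists2 y, sigma (x, y) & rho y < rho h.
Proof.
move=> cs [a [b [Ja ab bh]]] Jx.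
have /JrelP[[u [v [uS vS ->]]] _] : Jrel a x := etrans (esym Ja) Jx.
exists (ract (lact u b) v); first by apply: Cong_ract => //; exact: Cong_lact.
by apply: leq_ltn_trans bh; apply: rho_le; exact: ideal_biact.
Qed.

Lemma descends_Jrel sigma h k : Jrel h k ->
  descends sigma h -> descends sigma k.
Proof.
move=> hk [x [y [Jx xy yh]]]; exists x, y; split=> //.
  exact: etrans (esym hk) Jx.
by rewrite -(rho_Jrel hk).
Qed.

Lemma descends_sub sigma tau h : sigma `<=` tau ->
  descends sigma h -> descends tau h.
Proof.
by move=> st [x [y [Jx xy yh]]]; exists x, y; split=> //; exact: st.
Qed.

Lemma descent sigma x : Cong S sigma ->
  exists2 y, sigma (x, y) & ~ descends sigma y.
Proof.
move=> cs; have [k] := ubnP (rho x); elim: k x => // k IH x xk.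
have [dx|ndx] := pselect (descends sigma x); last first.
  by exists x; first exact: Cong_refl.
have [y xy yx] := descends_all cs dx (erefl : Jrel x x).
have [|z yz ndz] := IH y; first exact: leq_trans yx _.
by exists z => //; exact: Cong_trans yz.
Qed.

(** Multipliers that separate [x] from [y] send one of them to a smaller rank
    and keep the other in the J-class, so that [sigma] would descend. *)
Lemma Hseparable_descends sigma h x y : Cong S sigma -> Hseparable (Jclass h) ->
  ~ descends sigma h -> Jrel h x -> Jrel h y -> sigma (x, y) -> Hrel x y.
Proof.
move=> cs [_ sep] nd Jx Jy xy; apply: contrapT => nH; apply: nd.
have low z u v : Jrel h z -> S1 S u -> S1 S v -> ~ Jrel h (ract (lact u z) v) ->
    rho (ract (lact u z) v) < rho h.
  move=> Jz uS vS; apply: rho_lt; apply: (ideal_trans (y := z)).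
    by have /JrelP[] := Jz.
  exact: ideal_biact.
have [u [v [uS vS [[Ju nJ]|[nJ Ju]]]]] := sep x y Jx Jy nH.
  exists (ract (lact u x) v), (ract (lact u y) v); split=> //; last exact: low.
  by apply: Cong_ract => //; exact: Cong_lact.
exists (ract (lact u y) v), (ract (lact u x) v); split=> //; last exact: low.
by apply: Cong_ract => //; apply: Cong_lact => //; exact: Cong_sym.
Qed.

End Traces.
Arguments trace {S} h sigma _.

(** * The minimal J-class *)

(** A statement on an L-class and its dual on an R-class are proved at once:
    [op] is the product or its opposite, and [Lr] and [Rr] are L and R or R and
    L. *)
Section OneSided.
Local Open Scope group_scope.
Context {S : semigroupType} (op : S -> S -> S) (J : set S).
Context (Lr Rr : S -> S -> Prop) (A : set S) (sigma : set (S * S)).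
Hypothesis opA : associative op.
Hypothesis Lr_sym : forall x y, Lr x y -> Lr y x.
Hypothesis Lr_trans : forall y x z, Lr x y -> Lr y z -> Lr x z.
Hypothesis Rr_refl : forall x, Rr x x.
Hypothesis Rr_sym : forall x y, Rr x y -> Rr y x.
Hypothesis Rr_trans : forall y x z, Rr x y -> Rr y z -> Rr x z.
Hypothesis Lr_op : forall s x y, Lr x y -> Lr (op x s) (op y s).
Hypothesis Rr_op : forall s x y, Rr x y -> Rr (op s x) (op s y).
Hypothesis J_Lr : forall s x, J x -> Lr x (op s x).
Hypothesis J_Rr : forall s x, J x -> Rr x (op x s).
Hypothesis Rr_divides : forall x y, J x -> Rr x y -> exists u, y = op x u.
Hypothesis A_J : A `<=` J.
Hypothesis A_class : exists2 z, J z & A = [set y | Lr z y].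
Hypothesis sigma_eqv : equivalence_on [set: S] sigma.
Hypothesis sigma_opl : forall s x y, sigma (x, y) -> sigma (op s x, op s y).
Hypothesis sigma_opr : forall s x y, sigma (x, y) -> sigma (op x s, op y s).
Hypothesis A_max : forall tau : set (S * S),
  equivalence_on A tau /\
    (forall s x y, tau (x, y) -> tau (op s x, op s y)) ->
  ~ ((A `*` A `&` [set p | Rr p.1 p.2]) `<` tau /\ tau `<` nabla A).

(** On [A], the relations [sigma] and [Rr] commute, since [sigma] is compatible
    also with multiplications on the other side. So their product is a
    congruence of the act [A]. It is strictly above the restriction of [Rr],
    hence universal. A multiplication by an element of [A] transports this from
    [A] to [J]. *)
Lemma transversal_class :
  (exists a b, [/\ J a, J b, sigma (a, b) & ~ Rr a b]) ->
  forall a b, J a -> J b -> exists a', [/\ sigma (a, a'), Rr a' b & Lr a' a].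
Proof.
move=> [a0 [b0 [Ja0 Jb0 ab0 nR]]].
have [_ srefl ssym strans] := sigma_eqv.
have [z Jz AE] := A_class.
have Lr_refl x : J x -> Lr x x.
  by move=> Jx; apply: Lr_trans (J_Lr x Jx) (Lr_sym (J_Lr x Jx)).
have Az : A z by rewrite AE; exact: Lr_refl.
have ALr x y : A x -> A y -> Lr x y.
  by rewrite AE /= => zx zy; exact: Lr_trans (Lr_sym zx) zy.
have LrA x y : A x -> Lr x y -> A y by rewrite AE /=; exact: Lr_trans.
have Aop s x : A x -> A (op s x).
  by move=> Ax; exact: LrA Ax (J_Lr s (A_J Ax)).
pose tau := [set p | [/\ A p.1, A p.2 &
  exists x, [/\ sigma (p.1, x), A x & Rr x p.2]]].
have tauE : tau = nabla A.
  apply: contrapT => ntau.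
  apply: (A_max (tau := tau)); first split; first split.
  - by move=> [x y] [].
  - by move=> x Ax; split=> //; exists x; split=> //; exact: srefl.
  - move=> x y [/= Ax Ay [x' [xx' Ax' x'y]]]; split=> //=.
    have [u yE] := Rr_divides (A_J Ax') x'y.
    exists (op x u); split.
    + by rewrite yE; apply/ssym/sigma_opr.
    + by apply: LrA Ay _; rewrite yE; apply: Lr_op; exact: ALr.
    + exact/Rr_sym/J_Rr/A_J.
  - move=> x y w [/= Ax Ay [x' [xx' Ax' x'y]]] [/= _ Aw [y' [yy' Ay' y'w]]].
    split=> //=.
    have [u x'E] := Rr_divides (A_J Ay) (Rr_sym x'y).
    exists (op y' u); split.
    + by apply: strans xx' _; rewrite x'E; exact: sigma_opr.
    + by apply: LrA Ax' _; rewrite x'E; apply: Lr_op; exact: ALr.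
    + by apply: Rr_trans y'w; exact/Rr_sym/J_Rr/A_J.
  - move=> s x y [/= Ax Ay [x' [xx' Ax' x'y]]]; split; try exact: Aop.
    exists (op s x'); split; [exact: sigma_opl | exact: Aop | exact: Rr_op].
  - split; split=> [[x y]|].
    + by move=> [[Ax Ay] /= xy]; split=> //; exists x; split=> //; exact: srefl.
    + move=> /(_ (op a0 z, op b0 z)) - []; last first.
        move=> _ /= nab; apply: nR.
        apply: Rr_trans (J_Rr z Ja0) _; apply: Rr_trans nab _.
        exact/Rr_sym/J_Rr.
      split=> /=; try exact: Aop.
      exists (op b0 z); split; [exact: sigma_opr | exact: Aop | exact: Rr_refl].
    + by move=> [].
    + by move=> sub; apply: ntau; apply/seteqP; split=> [p []|].
move=> a b Ja Jb.
have : nabla A (op a z, op b z) by split; exact: Aop.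
rewrite -tauE => -[/= Aaz Abz [x [ax Ax xb]]].
have [w aE] := Rr_divides (A_J Aaz) (Rr_sym (J_Rr z Ja)).
exists (op x w); split.
- by rewrite {1}aE; exact: sigma_opr.
- apply: Rr_trans (Rr_sym (J_Rr w (A_J Ax))) _.
  by apply: Rr_trans xb _; exact/Rr_sym/J_Rr.
- by rewrite {1}aE; apply: Lr_op; exact: ALr.
Qed.

End OneSided.

Section MinimalClass.
Local Open Scope group_scope.
Context {S : semigroupType} (h0 : S).
Hypothesis St : stable S.
Hypothesis h0_min : forall x, ideal x h0.
Implicit Types (x y z a b : S) (u : option S) (sigma tau : set (S * S)).

Notation J0 := (Jclass h0).

Lemma min_ideal x y : J0 x -> ideal x y -> J0 y.
Proof.
move=> /JrelP[hx xh] xy; apply/JrelP; split; last exact: h0_min.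
exact: ideal_trans hx xy.
Qed.

Lemma min_Lrel s x : J0 x -> Lrel x (s * x).
Proof.
move=> Jx; apply: (stable_lact St (u := Some s)) => //.
apply: etrans (esym Jx) _; apply: min_ideal Jx _.
exact: (@ideal_lact _ (Some s)).
Qed.

Lemma min_Rrel s x : J0 x -> Rrel x (x * s).
Proof.
move=> Jx; apply: (stable_ract St (u := Some s)) => //.
apply: etrans (esym Jx) _; apply: min_ideal Jx _.
exact: (@ideal_ract _ (Some s)).
Qed.

Lemma min_Rdivides x y : J0 x -> Rrel x y -> exists s : S, y = x * s.
Proof.
move=> Jx xy; have /RrelP[[u _ <-] _] := etrans (esym (min_Rrel x Jx)) xy.
exists (ract x u); case: u => [s|] //=; by rewrite mulgA.
Qed.

Lemma min_Ldivides x y : J0 x -> Lrel x y -> exists s : S, y = s * x.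
Proof.
move=> Jx xy; have /LrelP[[u _ <-] _] := etrans (esym (min_Lrel x Jx)) xy.
exists (lact u x); case: u => [s|] //=; by rewrite mulgA.
Qed.

Definition within_R sigma :=
  forall a b, J0 a -> J0 b -> sigma (a, b) -> Rrel a b.
Definition within_L sigma :=
  forall a b, J0 a -> J0 b -> sigma (a, b) -> Lrel a b.

(** The points to add to the sum of the heights, [true] for L-classes and
    [false] for R-classes: an L-class is an H-class iff all elements of the
    minimal J-class are R-related ([Lclass_nabla]). *)
Definition excess : set bool :=
  [set b | if b then ~ within_R setT else ~ within_L setT].

Lemma Hrestr_Lclass z : Hrestr (Lclass z) =
  Lclass z `*` Lclass z `&` [set p | Rrel p.1 p.2].
Proof.
apply/seteqP; split=> -[x y] [[/= zx zy]]; first by case.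
by move=> /= Rxy; split=> //; split=> //; exact: etrans (esym zx) zy.
Qed.

Lemma Hrestr_Rclass z : Hrestr (Rclass z) =
  Rclass z `*` Rclass z `&` [set p | Lrel p.1 p.2].
Proof.
apply/seteqP; split=> -[x y] [[/= zx zy]]; first by case.
by move=> /= Rxy; split=> //; split=> //; exact: etrans (esym zx) zy.
Qed.

Lemma Lclass_nabla L : range (@Lclass S) L -> L `<=` J0 ->
  Hrestr L = nabla L <-> within_R setT.
Proof.
move=> [z _ <-] LJ; have Jz : J0 z by exact: LJ.
rewrite Hrestr_Lclass; split=> [E a b Ja Jb _|RT].
  have : nabla (Lclass z) (a * z, b * z) by split; exact: min_Lrel.
  rewrite -E => -[_ /= Rab]; apply: etrans (min_Rrel z Ja) _.
  by apply: etrans Rab _; exact/esym/min_Rrel.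
apply/seteqP; split=> [p []//|[x y] [/= zx zy]]; split=> //.
exact: (RT x y (LJ _ zx) (LJ _ zy)).
Qed.

Lemma Rclass_nabla R : range (@Rclass S) R -> R `<=` J0 ->
  Hrestr R = nabla R <-> within_L setT.
Proof.
move=> [z _ <-] LJ; have Jz : J0 z by exact: LJ.
rewrite Hrestr_Rclass; split=> [E a b Ja Jb _|RT].
  have : nabla (Rclass z) (z * a, z * b) by split; exact: min_Rrel.
  rewrite -E => -[_ /= Rab]; apply: etrans (min_Lrel z Ja) _.
  by apply: etrans Rab _; exact/esym/min_Lrel.
apply/seteqP; split=> [p []//|[x y] [/= zx zy]]; split=> //.
exact: (RT x y (LJ _ zx) (LJ _ zy)).
Qed.

Lemma not_withinP (Q : S -> S -> Prop) sigma :
  ~ (forall a b, J0 a -> J0 b -> sigma (a, b) -> Q a b) ->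
  exists a b, [/\ J0 a, J0 b, sigma (a, b) & ~ Q a b].
Proof.
move=> /existsNP[a] /existsNP[b] /not_implyP[Ja] /not_implyP[Jb].
by move=> /not_implyP[ab nQ]; exists a, b.
Qed.

Lemma Rrel_transversal L sigma a b : Cong S sigma ->
  range (@Lclass S) L -> L `<=` J0 ->
  maximal_cong L (lcong L) (Hrestr L) \/ Hrestr L = nabla L ->
  ~ within_R sigma -> J0 a -> J0 b ->
  exists a', [/\ sigma (a, a'), Rrel a' b & Lrel a' a].
Proof.
move=> [se sl sr] /[dup] Lr [z _ LE] LJ Lmax nR Ja Jb.
have [[_ _ maxL]|/(Lclass_nabla Lr LJ) RT] := Lmax; last first.
  by case: nR => x y Jx Jy _; exact: RT.
have Jz : J0 z by apply: LJ; rewrite -LE.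
apply: (@transversal_class S (fun x y => x * y) J0 (@Lrel S) (@Rrel S) L sigma)
  => //.
- by move=> y x w xy yw; exact: etrans xy yw.
- by move=> y x w xy yw; exact: etrans xy yw.
- by move=> s x y; exact: (@Lrel_ract S x y (Some s)).
- by move=> s x y; exact: (@Rrel_lact S x y (Some s)).
- exact: min_Lrel.
- exact: min_Rrel.
- exact: min_Rdivides.
- by exists z.
- by move=> tau ctau; rewrite -LE -Hrestr_Lclass LE; exact: maxL.
- exact: not_withinP.
Qed.

Lemma Lrel_transversal R sigma a b : Cong S sigma ->
  range (@Rclass S) R -> R `<=` J0 ->
  maximal_cong R (rcong R) (Hrestr R) \/ Hrestr R = nabla R ->
  ~ within_L sigma -> J0 a -> J0 b ->
  exists a', [/\ sigma (a, a'), Lrel a' b & Rrel a' a].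
Proof.
move=> [se sl sr] /[dup] Lr [z _ LE] LJ Lmax nR Ja Jb.
have [[_ _ maxL]|/(Rclass_nabla Lr LJ) RT] := Lmax; last first.
  by case: nR => x y Jx Jy _; exact: RT.
have Jz : J0 z by apply: LJ; rewrite -LE.
apply: (@transversal_class S (fun x y => y * x) J0 (@Rrel S) (@Lrel S) R sigma)
  => //.
- by move=> y x w xy yw; exact: etrans xy yw.
- by move=> y x w xy yw; exact: etrans xy yw.
- by move=> s x y; exact: (@Rrel_lact S x y (Some s)).
- by move=> s x y; exact: (@Lrel_ract S x y (Some s)).
- exact: min_Rrel.
- exact: min_Lrel.
- exact: min_Ldivides.
- by exists z.
- by move=> tau ctau; rewrite -LE -Hrestr_Rclass LE; exact: maxL.
- exact: not_withinP.
Qed.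

Context (L R : set S).
Hypothesis L_class : range (@Lclass S) L.
Hypothesis R_class : range (@Rclass S) R.
Hypothesis L_J0 : L `<=` J0.
Hypothesis R_J0 : R `<=` J0.
Hypothesis L_max : maximal_cong L (lcong L) (Hrestr L) \/ Hrestr L = nabla L.
Hypothesis R_max : maximal_cong R (rcong R) (Hrestr R) \/ Hrestr R = nabla R.

(** Starting from [a], first the R-class and then the L-class of [b] is reached
    within [sigma]. What remains to be bridged lies in one H-class. *)
Lemma min_class_le sigma tau a b : Cong S sigma -> Cong S tau ->
  sigma `<=` tau ->
  (within_R sigma -> within_R tau) -> (within_L sigma -> within_L tau) ->
  trace h0 tau `<=` trace h0 sigma ->
  J0 a -> J0 b -> tau (a, b) -> sigma (a, b).
Proof.
move=> cs ct st stR stL stT Ja Jb tab.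
have [a1 [sa1 R1]] : exists a1, sigma (a, a1) /\ Rrel a1 b.
  have [/stR tR|nR] := pselect (within_R sigma).
    by exists a; split; [exact: Cong_refl | exact: tR].
  have [a1 [? ? _]] := Rrel_transversal cs L_class L_J0 L_max nR Ja Jb.
  by exists a1.
have ta1 : tau (a1, b).
  by apply: Cong_trans tab => //; apply: Cong_sym => //; exact: st.
have Ja1 : J0 a1 by exact: etrans Jb (esym (Rrel_Jrel R1)).
have [a2 [sa2 L2 R2]] : exists a2, [/\ sigma (a1, a2), Lrel a2 b & Rrel a2 b].
  have [/stL tL|nL] := pselect (within_L sigma).
    by exists a1; split; [exact: Cong_refl | exact: tL |].
  have [a2 [? ? R2]] := Lrel_transversal cs R_class R_J0 R_max nL Ja1 Jb.
  by exists a2; split=> //; exact: etrans R2 R1.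
apply: (Cong_trans cs sa1); apply: (Cong_trans cs sa2).
apply: (trace_le St cs ct stT) => //.
  exact: etrans Jb (esym (Rrel_Jrel R2)).
by apply: Cong_trans ta1 => //; apply: Cong_sym => //; exact: st.
Qed.

End MinimalClass.

(** * Chains of congruences: the upper bound *)

(** J-classes are ranked by the number of classes below them, and those with the
    same number by their index. *)
Lemma linear_extension (S : semigroupType) (n : nat) (h : 'I_n.+1 -> S) :
  (forall x, exists r, Jrel (h r) x) ->
  (forall r q, Jrel (h r) (h q) -> r = q) ->
  exists rho : S -> nat, (forall x y, ideal y x -> rho x <= rho y) /\
    (forall x y, rho x = rho y -> Jrel x y).
Proof.
move=> /boolp.choice[idx idxP] h_inj.
pose below r := [pred q | `[< ideal (h r) (h q) >]].
exists (fun x => #|below (idx x)| * n.+1 + idx x); split=> x y; last first.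
  move=> /(congr1 (modn^~ n.+1)); rewrite /= !modnMDl !modn_small //.
  move=> /val_inj xy; apply: etrans (esym (idxP x)) _.
  by rewrite xy; exact: idxP.
move=> yx; have [E|nE] := eqVneq (idx x) (idx y); first by rewrite E.
have qr : ideal (h (idx y)) (h (idx x)).
  have /JrelP[hy _] := idxP y; have /JrelP[_ xh] := idxP x.
  exact: ideal_trans hy (ideal_trans yx xh).
have lt : #|below (idx x)| < #|below (idx y)|.
  apply/proper_card/properP; split.
    apply/fintype.subsetP => k /asboolP rk; apply/asboolP.
    exact: ideal_trans qr rk.
  exists (idx y); first exact/asboolP/ideal_refl.
  apply/negP => /asboolP rq; move/eqP: nE; apply.
  by apply: h_inj; exact/JrelP.
apply: (@leq_trans (#|below (idx x)|.+1 * n.+1)).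
  by rewrite mulSnr leq_add2l ltnW.
by apply: leq_trans (leq_addr _ _); rewrite leq_mul2r lt orbT.
Qed.

Section Heights.
Local Open Scope group_scope.
Context (S : semigroupType) (n : nat) (h : 'I_n.+1 -> S) (rho : S -> nat).
Hypothesis St : stable S.
Hypothesis h_repr : forall x, exists r, Jrel (h r) x.
Hypothesis h_min : forall x, ideal x (h ord0).
Hypothesis rho_le : forall x y, ideal y x -> rho x <= rho y.
Hypothesis rho_J : forall x y, rho x = rho y -> Jrel x y.
Implicit Types (sigma tau : set (S * S)) (r : 'I_n.+1).

Notation h0 := (h ord0).
Notation G r := (schutzenberger (h r)).

Lemma min_not_descends sigma : ~ descends rho sigma h0.
Proof.
by move=> [x [y [_ _]]]; rewrite ltnNge rho_le //; exact: h_min.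
Qed.

Section UpperBound.
Hypothesis h_sep : forall r, r <> ord0 -> Hseparable (Jclass (h r)).
Context (L R : set S).
Hypothesis L_class : range (@Lclass S) L.
Hypothesis R_class : range (@Rclass S) R.
Hypothesis L_J0 : L `<=` Jclass h0.
Hypothesis R_J0 : R `<=` Jclass h0.
Hypothesis L_max : maximal_cong L (lcong L) (Hrestr L) \/ Hrestr L = nabla L.
Hypothesis R_max : maximal_cong R (rcong R) (Hrestr R) \/ Hrestr R = nabla R.

(** The coordinates of a congruence: for [i <= n] its descending or else its
    trace at the J-class of index [i], then its containment in R and in L on the
    minimal J-class. *)
Definition agree (i : nat) sigma tau :=
  [/\ forall r, i = r ->
        (descends rho sigma (h r) <-> descends rho tau (h r)) /\
        (~ descends rho sigma (h r) -> trace (h r) sigma = trace (h r) tau),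
      i = n.+1 -> (within_R h0 sigma <-> within_R h0 tau) &
      i = n.+2 -> (within_L h0 sigma <-> within_L h0 tau)].

Lemma agree_sym i sigma tau : agree i sigma tau -> agree i tau sigma.
Proof.
move=> [D WR WL]; split=> [r /D[dd tt]|/WR|/WL]; try by symmetry.
by split=> [|nd]; [symmetry | apply/esym/tt; rewrite dd].
Qed.

Lemma agree_convex i sigma tau upsilon : sigma `<=` tau -> tau `<=` upsilon ->
  agree i sigma upsilon -> agree i sigma tau.
Proof.
move=> st tu [D WR WL]; split=> [r ir|e|e].
- have [dd tt] := D r ir; split=> [|nd].
    by split=> [|dt]; [exact: descends_sub | apply/dd; exact: descends_sub dt].
  apply/seteqP; split; first exact: trace_sub.
  by rewrite tt //; exact: trace_sub.
- split=> W a b Ja Jb ab; last by apply: W => //; exact: st.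
  by apply: ((WR e).1 W) => //; exact: tu.
- split=> W a b Ja Jb ab; last by apply: W => //; exact: st.
  by apply: ((WL e).1 W) => //; exact: tu.
Qed.

(** A pair of [tau] is replaced, modulo [sigma], by one between elements at
    whose classes [sigma], and so [tau], does not descend. These have the same
    rank and are therefore J-related, and the trace decides. *)
Lemma agree_all_sub sigma tau : Cong S sigma -> Cong S tau -> sigma `<=` tau ->
  (forall i, i < n.+3 -> agree i sigma tau) -> tau `<=` sigma.
Proof.
move=> cs ct st ag [x y] xy.
have agd r : (descends rho sigma (h r) <-> descends rho tau (h r)) /\
    (~ descends rho sigma (h r) -> trace (h r) sigma = trace (h r) tau).
  have [|/(_ r erefl)] // := ag r.
  by rewrite (ltn_trans (ltn_ord r)) // ltnW.
have [x' xx' ndx] := descent rho_le x cs.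
have [y' yy' ndy] := descent rho_le y cs.
have txy : tau (x', y').
  apply: (Cong_trans (y := x) ct); first by apply: (Cong_sym ct); exact: st.
  by apply: (Cong_trans ct xy); exact: st.
suff sxy : sigma (x', y').
  apply: (Cong_trans cs xx'); apply: (Cong_trans cs sxy).
  exact: Cong_sym.
have [r Jrx] := h_repr x'; have [q Jqy] := h_repr y'.
have nds : ~ descends rho sigma (h r).
  by move/(descends_Jrel rho_le Jrx).
have ndt : ~ descends rho tau (h r) by rewrite -(agd r).1.
have ndt' : ~ descends rho tau (h q).
  by rewrite -(agd q).1; move/(descends_Jrel rho_le Jqy).
have Jry : Jrel (h r) y'.
  apply: (etrans Jrx); apply: rho_J.
  apply/eqP; rewrite eqn_leq; apply/andP; split.
    rewrite leqNgt; apply/negP => lt; apply: ndt; exists x', y'.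
    by rewrite (rho_Jrel rho_le Jrx).
  rewrite leqNgt; apply/negP => lt; apply: ndt'; exists y', x'.
  by rewrite (rho_Jrel rho_le Jqy); split=> //; exact: Cong_sym.
have ts : trace (h r) tau `<=` trace (h r) sigma by rewrite (agd r).2.
have [r0|/eqP r0] := eqVneq r ord0; last first.
  have Hxy := Hseparable_descends rho_le rho_J ct (h_sep r0) ndt Jrx Jry txy.
  exact: (trace_le St cs ct ts).
rewrite r0 in Jrx Jry ts.
apply: (min_class_le St h_min L_class R_class L_J0 R_J0 L_max R_max cs ct)
  => //.
  by case: (ag n.+1) => [//|_ /(_ erefl)[]].
by case: (ag n.+2) => [//|_ _ /(_ erefl)[]].
Qed.

(** A label after the first coordinate is never at the last value there, which
    excludes descending. At the first coordinate no congruence descends, as its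
    J-class is minimal. *)
Lemma Cong_chain_bound :
  chain_bound (Cong S) [set: {r : 'I_n.+1 & Ht (NSub (G r))} + excess h0].
Proof.
move=> C [CC Ctot]; apply/card_leEx.
have le_sub sigma tau : (sigma <= tau)%O -> sigma `<=` tau.
  by rewrite subsetEset.
have ag_convex i sigma tau upsilon : (sigma <= tau)%O -> (tau <= upsilon)%O ->
    agree i sigma upsilon -> agree i sigma tau.
  by move=> /le_sub + /le_sub; exact: agree_convex.
have ag_sep sigma tau : C sigma -> C tau ->
    (forall i, i < n.+3 -> agree i sigma tau) -> sigma = tau.
  move=> Cs Ct ag; have [/le_sub st|/le_sub ts] := Ctot _ _ Cs Ct.
    by apply/seteqP; split=> //; apply: agree_all_sub => //; exact: CC.
  apply/seteqP; split=> //; apply: agree_all_sub => //; try exact: CC.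
  by move=> i /ag/agree_sym.
have [lab [lab_lt lab_top lab_inj]] :=
  chain_labels Ctot agree_sym ag_convex ag_sep.
have lab_up sigma : C sigma -> lab sigma <> 0 -> exists tau,
    [/\ C tau, sigma `<=` tau & ~ agree (lab sigma) sigma tau].
  move=> Cs l0; have [//|[tau [Ct st nag]]] := lab_top sigma Cs.
  by exists tau; split=> //; apply: le_sub; exact: Order.POrderTheory.ltW st.
(* Otherwise no later element of the chain could differ from [sigma] at [r];
   but one does, as the label is not 0. *)
have lab_descends sigma r : C sigma -> lab sigma = r ->
    ~ descends rho sigma (h r).
  move=> Cs lr; have [->|/eqP r0] := eqVneq r ord0.
    exact: min_not_descends.
  have [|tau [Ct st nag]] := lab_up sigma Cs.
    by rewrite lr => E; apply: r0; exact: val_inj.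
  move=> dr; apply: nag; rewrite lr; split.
  - move=> q /val_inj <-; split; last by move=> /(_ dr).
    by split=> // _; exact: descends_sub dr.
  - by move=> E; have := ltn_ord r; rewrite E ltnn.
  - by move=> E; have := ltn_ord r; rewrite E ltnNge leqnSn.
have lab_R sigma : C sigma -> lab sigma = n.+1 ->
    within_R h0 sigma /\ ~ within_R h0 setT.
  move=> Cs l; have [|tau [Ct st nag]] := lab_up sigma Cs; first by rewrite l.
  have nW : ~ (within_R h0 sigma <-> within_R h0 tau).
    move=> W; apply: nag; rewrite l; split=> // [r E|/eqP].
      by have := ltn_ord r; rewrite -E ltnn.
    by rewrite eqn_leq ltnn andbF.
  split.
    apply: contrapT => nWs; apply: nW; split=> // Wt; case: nWs => a b Ja Jb ab.
    by apply: Wt => //; exact: st.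
  by move=> WT; apply: nW; split=> _ a b Ja Jb _; exact: WT.
have lab_L sigma : C sigma -> lab sigma = n.+2 ->
    within_L h0 sigma /\ ~ within_L h0 setT.
  move=> Cs l; have [|tau [Ct st nag]] := lab_up sigma Cs; first by rewrite l.
  have nW : ~ (within_L h0 sigma <-> within_L h0 tau).
    move=> W; apply: nag; rewrite l; split=> // [r E|/eqP].
      by have := ltn_ord r; rewrite -E ltnNge leqnSn.
    by rewrite eqn_leq ltnn.
  split.
    apply: contrapT => nWs; apply: nW; split=> // Wt; case: nWs => a b Ja Jb ab.
    by apply: Wt => //; exact: st.
  by move=> WT; apply: nW; split=> _ a b Ja Jb _; exact: WT.
pose D r := [set trace (h r) sigma | sigma in C].
have f r : {f : D r -> Ht (NSub (G r)) | injective f}.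
  apply/cid/card_leEx/chain_bound_Ht; split.
    by move=> _ [sigma /CC Cs <-]; exact: trace_NSub.
  move=> _ _ [sigma Cs <-] [tau Ct <-]; rewrite !subsetEset.
  by have [/le_sub st|/le_sub ts] := Ctot _ _ Cs Ct; [left | right];
    exact: trace_sub.
have code (c : C) : exists s : {r : 'I_n.+1 & Ht (NSub (G r))} + excess h0,
    match s with
    | inl p => lab (val c) = tag p /\ exists t : D (tag p),
        val t = trace (h (tag p)) (val c) /\ sval (f (tag p)) t = tagged p
    | inr b => lab (val c) = if val b then n.+1 else n.+2
    end.
  have Cc : C (val c) := set_mem (valP c).
  have [l|l] := ltnP (lab (val c)) n.+1.
    have Dc : D (Ordinal l) (trace (h (Ordinal l)) (val c)) by exists (val c).
    pose t : D (Ordinal l) := SigSub (mem_set Dc).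
    by exists (inl (existT _ (Ordinal l) (sval (f _) t))); split=> //; exists t.
  have [E|nE] := eqVneq (lab (val c)) n.+1.
    have eR : excess h0 true by have [] := lab_R _ Cc E.
    by exists (inr (SigSub (mem_set eR))).
  have {l nE} E : lab (val c) = n.+2.
    by apply/eqP; rewrite eqn_leq -ltnS lab_lt //= ltn_neqAle eq_sym nE.
  have eL : excess h0 false by have [] := lab_L _ Cc E.
  by exists (inr (SigSub (mem_set eL))).
have [F FP] := boolp.choice code.
have labeled (c : C) : C (val c) := set_mem (valP c).
suff Finj : injective F.
  have FT c : F c \in [set: {r : 'I_n.+1 & Ht (NSub (G r))} + excess h0].
    exact: mem_set.
  by exists (fun c => SigSub (FT c)) => c c' [/Finj].
move=> c c' E; have := FP c'; have := FP c; rewrite -E.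
case: (F c) => [[r x]|b] /=.
  move=> [l [t [tE ft]]] [l' [t' [tE' ft']]].
  have tt : t = t' by apply: (svalP (f r)); rewrite ft ft'.
  apply: val_inj; apply: lab_inj => //; first by rewrite l l'.
  rewrite l; split=> [q /val_inj <-|E'|E'].
  - have n1 := lab_descends _ r (labeled c) l.
    have n2 := lab_descends _ r (labeled c') l'.
    by split=> // _; rewrite -tE -tE' tt.
  - by have := ltn_ord r; rewrite E' ltnn.
  - by have := ltn_ord r; rewrite E' ltnNge leqnSn.
case: (val b) => l l'; apply: val_inj; apply: lab_inj => //; rewrite ?l //.
- split=> [r E'|_|/eqP].
  + by have := ltn_ord r; rewrite -E' ltnn.
  + have [W _] := lab_R _ (labeled c) l; have [W' _] := lab_R _ (labeled c') l'.
    by [].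
  + by rewrite eqn_leq ltnn andbF.
- split=> [r E'|/eqP|_].
  + by have := ltn_ord r; rewrite -E' ltnNge leqnSn.
  + by rewrite eqn_leq ltnn.
  + have [W _] := lab_L _ (labeled c) l; have [W' _] := lab_L _ (labeled c') l'.
    by [].
Qed.

End UpperBound.

(** * Chains of congruences: the lower bound *)

Section LowerBound.
Hypothesis h_inj : forall r q, Jrel (h r) (h q) -> r = q.

Definition min_R : set (S * S) :=
  [set p | p.1 = p.2 \/ [/\ Jclass h0 p.1, Jclass h0 p.2 & Rrel p.1 p.2]].

Lemma min_R_Cong : Cong S min_R.
Proof.
have lJ s x : Jclass h0 x -> Jclass h0 (s * x).
  by move=> Jx; exact: etrans Jx (Lrel_Jrel (min_Lrel St h_min s Jx)).
have rJ s x : Jclass h0 x -> Jclass h0 (x * s).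
  by move=> Jx; exact: etrans Jx (Rrel_Jrel (min_Rrel St h_min s Jx)).
split; first split.
- by [].
- by move=> x _; left.
- by move=> x y [/= ->|[/= Jx Jy xy]]; [left | right].
- move=> x y z [/= -> //|[/= Jx Jy xy]] [/= <-|[/= _ Jz yz]]; right=> //.
  by split=> //; exact: etrans xy yz.
- move=> s x y [/= ->|[/= Jx Jy xy]]; [by left | right; split=> /=].
  + exact: lJ.
  + exact: lJ.
  + exact: (@Rrel_lact S x y (Some s)).
- move=> s x y [/= ->|[/= Jx Jy xy]]; [by left | right; split=> /=].
  + exact: rJ.
  + exact: rJ.
  + apply: etrans (esym (min_Rrel St h_min s Jx)) _.
    exact: etrans xy (min_Rrel St h_min s Jy).
Qed.

Context (C : forall r, set (set (G r))).
Arguments C : clear implicits.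
Hypothesis C_chain : forall r, chain_in (NSub (G r)) (C r).

Let index := ({r : 'I_n.+1 & C r} + excess h0)%type.

Definition level (s : index) : 'I_n.+1 := if s is inl p then tag p else ord0.

(** For [r <> ord0] the trivial group is used as the name of the congruence
    that is universal up to [J_r], because [extension rho [set 1]] is the
    congruence that is universal below [J_r], which may be in the chain
    already. *)
Definition chain_cong (s : index) : set (S * S) :=
  match s with
  | inl (existT r N) => if `[< r <> ord0 /\ val N = [set 1] >]
                        then rees rho (rho (h r)).+1 else extension rho (val N)
  | inr b => if `[< val b \/ within_R h0 setT >]
             then rees rho (rho h0).+1 else min_R
  end.

Lemma C_NSub r (N : C r) : NSub _ (val N).
Proof. by apply: (C_chain r).1; exact: set_mem (valP N). Qed.

Lemma chain_cong_Cong s : Cong S (chain_cong s).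
Proof.
case: s => [[r N]|b] /=; case: asboolP => _; try exact: rees_Cong.
- exact: (extension_Cong St rho_le rho_J (C_NSub N)).
- exact: min_R_Cong.
Qed.

Lemma rho_min x : rho h0 <= rho x.
Proof. exact/rho_le/h_min. Qed.

Lemma chain_cong_upper s : chain_cong s `<=` rees rho (rho (h (level s))).+1.
Proof.
case: s => [[r N]|b] /=; case: asboolP => _ //; first exact: extension_rees.
move=> [x y] [/= ->|[/= Jx Jy _]]; [by left | right=> /=].
by rewrite -(rho_Jrel rho_le Jx) -(rho_Jrel rho_le Jy).
Qed.

Lemma chain_cong_lower s : rees rho (rho (h (level s))) `<=` chain_cong s.
Proof.
case: s => [[r N]|b] /=; case: asboolP => _.
- exact: rees_sub.
- by move=> p; left.
- exact: rees_sub.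
- by move=> [x y] [/= ->|[]]; [left | rewrite ltnNge rho_min].
Qed.

Lemma chain_cong_strict s : level s <> ord0 ->
  ~ (chain_cong s `<=` rees rho (rho (h (level s)))).
Proof.
case: s => [[r N]|b] //= r0; have lt0 : rho h0 < rho (h r).
  rewrite ltn_neqAle rho_min andbT; apply/eqP => /rho_J/h_inj E.
  by apply: r0.
have Hh := Hrel_refl (h r).
case: asboolP => [_ /(_ (h r, h0))|N1 sub].
  case; first by right=> /=; split=> //; exact: ltnW.
  - by move=> /= E; rewrite E ltnn in lt0.
  - by case; rewrite ltnn.
apply: N1; split=> //; have [[N1 _] _] := C_NSub N.
apply/seteqP; split=> [f fN|_ ->]; last exact: set_mem.
have : trace (h r) (extension rho (val N)) f.
  by rewrite (trace_extension St rho) //; exact: C_NSub.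
move=> /sub[/= E|[]]; last by rewrite ltnn.
by apply: tr_inj; rewrite tr1 // -E.
Qed.

Lemma chain_cong_lt s t : rho (h (level s)) < rho (h (level t)) ->
  chain_cong s `<=` chain_cong t /\ chain_cong s <> chain_cong t.
Proof.
move=> st; have sub : chain_cong s `<=` rees rho (rho (h (level t))).
  by move=> p /chain_cong_upper; exact: rees_sub.
split=> [|E]; first by move=> p /sub; exact: chain_cong_lower.
have t0 : level t <> ord0.
  by move=> E0; move: st; rewrite E0 ltnNge rho_min.
by apply: (chain_cong_strict t0); rewrite -E.
Qed.

Lemma chain_cong_inl r (N M : C r) :
  (chain_cong (inl (existT _ r N)) `<=` chain_cong (inl (existT _ r M)) \/
   chain_cong (inl (existT _ r M)) `<=` chain_cong (inl (existT _ r N))) /\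
  (chain_cong (inl (existT _ r N)) = chain_cong (inl (existT _ r M)) -> N = M).
Proof.
have CU := @chain_cong_upper (inl (existT _ r _)).
have neq (M' : C r) : r <> ord0 ->
    rees rho (rho (h r)).+1 <> extension rho (val M').
  move=> r0 E; have lt0 : rho h0 < rho (h r).
    rewrite ltn_neqAle rho_min andbT; apply/eqP => /rho_J/h_inj E0.
    by apply: r0.
  have : rees rho (rho (h r)).+1 (h r, h0).
    by right=> /=; split=> //; exact: ltnW.
  rewrite E => -[[/= E'|[]]|[/= _ /Hrel_Jrel J _]].
  - by rewrite E' ltnn in lt0.
  - by rewrite ltnn.
  - by move: lt0; rewrite (rho_Jrel rho_le J) ltnn.
move: (CU N) (CU M) => /=.
case: asboolP => [[r0 N1]|nN]; case: asboolP => [[r0' M1]|nM] UN UM; split.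
- by left.
- by move=> _; apply: val_inj; exact: etrans N1 (esym M1).
- by right.
- by move=> /neq.
- by left.
- by move=> /esym/neq.
- have [_ tot] := C_chain r.
  have := tot _ _ (set_mem (valP N)) (set_mem (valP M)).
  by rewrite !subsetEset => -[NM|MN]; [left | right]; exact: extension_sub.
- move=> E; apply: val_inj.
  rewrite -(trace_extension St rho (C_NSub N)) E.
  by rewrite (trace_extension St rho (C_NSub M)).
Qed.

Lemma chain_cong_inl_inr (N : C ord0) b :
  chain_cong (inl (existT _ ord0 N)) `<=` chain_cong (inr b) /\
  chain_cong (inl (existT _ ord0 N)) <> chain_cong (inr b).
Proof.
have minR : extension rho (val N) `<=` min_R.
  move=> [x y] [[/= ->|[]]|[/= Jx Hxy _]]; first by left.
    by rewrite ltnNge rho_min.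
  right; split=> //=; last by case: Hxy.
  exact: etrans Jx (Hrel_Jrel Hxy).
have NH x y : Jclass h0 x -> Jclass h0 y ->
    extension rho (val N) (x, y) -> Hrel x y.
  by move=> Jx Jy [[/= ->|[]]|[]] //; rewrite ltnNge rho_min.
have top x y : Jclass h0 x -> Jclass h0 y -> rees rho (rho h0).+1 (x, y).
  move=> Jx Jy; right.
  by rewrite /= -(rho_Jrel rho_le Jx) -(rho_Jrel rho_le Jy).
rewrite /=; case: asboolP => [[]//|_].
case: asboolP => [bR|nbR]; split=> //.
- exact: extension_rees.
- move=> E; have := set_mem (valP b); rewrite /excess /=.
  case: (val b) => nW; apply: nW => x y Jx Jy _.
    by have [] // := NH x y Jx Jy; rewrite E; exact: top.
  by have [] // := NH x y Jx Jy; rewrite E; exact: top.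
- move=> E; have := set_mem (valP b); rewrite /excess /=.
  case: (val b) nbR => [|_]; first by case; left.
  (* Otherwise R is contained in H on the minimal class; so [x] is L-related to
     [x * y], which is L-related to [y]. *)
  apply=> x y Jx Jy _.
  have Rxy := min_Rrel St h_min y Jx; have Lyx := min_Lrel St h_min x Jy.
  have Jxy : Jclass h0 (x * y) := etrans Jx (Rrel_Jrel Rxy).
  have [|Lx _] := NH x (x * y) Jx Jxy; first by rewrite E; right.
  exact: etrans Lx (esym Lyx).
Qed.

Lemma chain_cong_inr b b' :
  (chain_cong (inr b) `<=` chain_cong (inr b') \/
   chain_cong (inr b') `<=` chain_cong (inr b)) /\
  (chain_cong (inr b) = chain_cong (inr b') -> b = b').
Proof.
have minR : min_R `<=` rees rho (rho h0).+1.
  move=> [x y] [/= ->|[/= Jx Jy _]]; first by left.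
  by right; rewrite /= -(rho_Jrel rho_le Jx) -(rho_Jrel rho_le Jy).
have neq : excess h0 true -> rees rho (rho h0).+1 <> min_R.
  move=> nW E; apply: nW => x y Jx Jy _.
  have : rees rho (rho h0).+1 (x, y).
    by right; rewrite /= -(rho_Jrel rho_le Jx) -(rho_Jrel rho_le Jy).
  by rewrite E => -[/= ->|[]].
have := set_mem (valP b); have := set_mem (valP b'); rewrite /=.
case: asboolP => Pb; case: asboolP => Pb' eb' eb; split; try by [left|right].
- move=> _; apply: val_inj => /=; move: Pb Pb' eb eb'.
  by case: (sval b); [move=> _ | move=> -[//|W]];
    case: (sval b') => //= -[].
- by case: Pb => [bT /neq|W]; [case; rewrite -bT | case: Pb'; right].
- by case: Pb' => [bT /esym/neq|W]; [case; rewrite -bT | case: Pb; right].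
- move=> _; apply: val_inj => /=; move: Pb Pb'.
  by case: (sval b) => [[]|]; [left | case: (sval b') => // _ []; left].
Qed.

Lemma Cong_chain_exists (U : Type) (K : set U) : chain_bound (Cong S) K ->
  exists f : index -> K, injective f.
Proof.
have cmp s t :
    (chain_cong s `<=` chain_cong t \/ chain_cong t `<=` chain_cong s) /\
    (chain_cong s = chain_cong t -> s = t).
  have [st|ts|E] := ltngtP (rho (h (level s))) (rho (h (level t))).
  - by have [sub ne] := chain_cong_lt st; split; [left|].
  - by have [sub ne] := chain_cong_lt ts; split; [right|move/esym].
  move: E => /rho_J/h_inj.
  case: s => [[r N]|b]; case: t => [[q M]|b'] /=.
  - move=> rq; case: _ / rq M => M; have [sub inj] := chain_cong_inl N M.
    by split=> // /inj ->.
  - move=> r0; rewrite r0 in N *; have [sub ne] := chain_cong_inl_inr N b'.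
    by split; [left|].
  - move=> /esym r0; rewrite r0 in M *; have [sub ne] := chain_cong_inl_inr M b.
    by split; [right|move/esym].
  - by move=> _; have [sub inj] := chain_cong_inr b b'; split=> // /inj ->.
move=> ubK; have /card_leEx[f f_inj] : range chain_cong #<= K.
  apply: ubK; split=> [_ [s _ <-]|_ _ [s _ <-] [t _ <-]].
    exact: chain_cong_Cong.
  by rewrite !subsetEset; exact: (cmp s t).1.
have cR s : range chain_cong (chain_cong s) by exists s.
exists (fun s => f (SigSub (mem_set (cR s)))) => s t /f_inj [].
exact: (cmp s t).2.
Qed.

End LowerBound.

End Heights.

(** * The height of the lattice of congruences *)

Lemma card_excess (P Q : Prop) :
  [set b : bool | if b then ~ P else ~ Q] #=
  [set: 'I_(if `[< P >] then if `[< Q >] then 0 else 1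
            else if `[< Q >] then 1 else 2)].
Proof.
set E := [set b | _]; apply: card_eq_trans (card_II).
have [p|np] := asboolP P; have [q|nq] := asboolP Q.
- have -> : E = set0 by apply/seteqP; split=> // -[].
  by rewrite II0 card_eq00.
- have -> : E = [set false] by apply/seteqP; split=> [[]//|_ ->].
  exact: card_set1.
- have -> : E = [set true] by apply/seteqP; split=> [[]//|_ ->].
  exact: card_set1.
- have -> : E = setT by apply/seteqP; split=> // -[].
  rewrite card_eq_le; apply/andP; split; apply/card_leEx.
    have b2 (b : bool) : `I_2 (nat_of_bool b) by case: b.
    exists (fun b => SigSub (mem_set (b2 (val b)))) => b c [bc].
    by apply: val_inj; move: bc => /=; case: (sval b); case: (sval c).
  exists (fun i => SigSub (mem_set (I : [set: bool] (val i == 1)))) => i k.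
  have := set_mem (valP i); have := set_mem (valP k) => /= k2 i2 [ik].
  by apply: val_inj => /=; case: (sval i) (sval k) i2 k2 ik => [|[]] [|[]].
Qed.

Lemma sum_inr_inj (A E F : Type) : (exists f : E -> F, injective f) ->
  exists g : A + E -> A + F, injective g.
Proof.
move=> [f f_inj].
exists (fun s => match s with inl a => inl a | inr e => inr (f e) end).
by move=> [a|e] [b|e'] //= [] => [->|/f_inj ->].
Qed.

Theorem corollary9p12 (S : semigroupType) (n : nat) (J : 'I_n.+1 -> set S)
    (h : 'I_n.+1 -> S) (L R : set S)
    (Sstable : stable S)
    (Jenum : set_bij [set: 'I_n.+1] (range (@Jclass S)) J)
    (J1min : minimal_Jclass (J ord0))
    (Jsep : forall r, r <> ord0 -> Hseparable (J r))
    (hJ : forall r, J r (h r))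
    (Lhyp : exists L' : set S, [/\ range (@Lclass S) L', L' `<=` J ord0 &
      unique_maximal_cong L' (lcong L') (Hrestr L') \/ Hrestr L' = nabla L'])
    (Rhyp : exists R' : set S, [/\ range (@Rclass S) R', R' `<=` J ord0 &
      unique_maximal_cong R' (rcong R') (Hrestr R') \/ Hrestr R' = nabla R'])
    (Lclass_L : range (@Lclass S) L) (LJ1 : L `<=` J ord0)
    (Rclass_R : range (@Rclass S) R) (RJ1 : R `<=` J ord0) :
  Ht (Cong S) #=
    [set: ({r : 'I_n.+1 & Ht (NSub (schutzenberger (h r)))} +
           'I_(if `[< Hrestr L = nabla L >]
               then if `[< Hrestr R = nabla R >] then 0 else 1
               else if `[< Hrestr R = nabla R >] then 1 else 2))%type].
Proof.
have [J_fun J_inj J_surj] := Jenum.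
have JE r : J r = Jclass (h r).
  have [z _ zJ] := J_fun r I.
  have := hJ r; rewrite -zJ /Jclass /= => zh.
  by apply/seteqP; split=> x /=; rewrite /Jrel zh.
have h_repr x : exists r, Jrel (h r) x.
  have [|r _ rx] := J_surj (Jclass x); first by exists x.
  by exists r; have : Jclass x x := erefl; rewrite -rx JE.
have h_inj r q : Jrel (h r) (h q) -> r = q.
  move=> rq; apply: J_inj; rewrite ?inE // !JE.
  by apply/seteqP; split=> x; rewrite /Jclass /= /Jrel rq.
have h_min x : ideal x (h ord0).
  have [_ Jmin] := J1min; rewrite JE in Jmin.
  (* [h0 * x] is below both [x] and the minimal class. *)
  pose y : S := (h ord0 * x)%g.
  have hy : ideal (h ord0) y by exact: (@ideal_ract _ (Some x)).
  have xy : ideal x y by exact: (@ideal_lact _ (Some (h ord0))).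
  suff E : Jclass y = Jclass (h ord0).
    apply: ideal_trans xy _; have : Jclass y y := erefl.
    by rewrite E => /JrelP[].
  apply: Jmin; [by exists y | move=> a b ya hb; apply/idealS].
  have /JrelP[_ bh] : Jrel (h ord0) b := hb.
  have /JrelP[ya' _] : Jrel y a := ya.
  exact: ideal_trans bh (ideal_trans hy ya').
have [rho [rho_le rho_J]] := linear_extension h_repr h_inj.
rewrite JE in LJ1 RJ1.
have maxu (A : set S) Cg s : unique_maximal_cong A Cg s \/ s = nabla A ->
  maximal_cong A Cg s \/ s = nabla A by case=> [[]|]; [left|right].
have [L' [L'c L'J /maxu L'm]] := Lhyp; have [R' [R'c R'J /maxu R'm]] := Rhyp.
rewrite JE in L'J R'J.
have sep r : r <> ord0 -> Hseparable (Jclass (h r)) by move=> /Jsep; rewrite JE.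
have EL := Lclass_nabla Sstable h_min Lclass_L LJ1.
have ER := Rclass_nabla Sstable h_min Rclass_R RJ1.
have := card_excess (Hrestr L = nabla L) (Hrestr R = nabla R).
set k := if _ then _ else _ => Ek.
have XE : excess (h ord0) =
    [set b : bool | if b then ~ Hrestr L = nabla L else ~ Hrestr R = nabla R].
  apply/seteqP; split=> -[] /=; by rewrite ?EL ?ER.
have := Ek; rewrite -XE card_eq_le.
move=> /andP[/card_leEx[e e_inj] /card_leEx[e' e'_inj]].
rewrite card_eq_le; apply/andP; split; last first.
  apply/card_leEx.
  have [f f_inj] : exists f :
      {r : 'I_n.+1 & Ht (NSub (schutzenberger (h r)))} + 'I_k -> Ht (Cong S),
      injective f.
    apply: (@Ht_sum_le _ _ (fun r => set (schutzenberger (h r)))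
      (fun r => NSub (schutzenberger (h r))) _ _ _ (@nat_of_ord k)) => [|C CN].
      exact: val_inj.
    have [f f_inj] := Cong_chain_exists Sstable h_min rho_le rho_J h_inj CN
      (@chain_bound_Ht _ _ (Cong S)).
    have /(sum_inr_inj {r : 'I_n.+1 & C r})[g g_inj] :
        exists i : 'I_k -> excess (h ord0), injective i.
      exists (fun i => e' (SigSub (mem_set (I : [set: 'I_k] i)))).
      by move=> i j /e'_inj [].
    by exists (f \o g); exact: inj_comp.
  by exists (fun s => f (val s)) => s t /f_inj/val_inj.
apply: card_le_trans (Ht_le (Cong_chain_bound Sstable h_repr h_min rho_le rho_J
  sep L'c R'c L'J R'J L'm R'm)) _.
have /(sum_inr_inj {r : 'I_n.+1 & Ht (NSub (schutzenberger (h r)))})[g g_inj] :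
    exists i : excess (h ord0) -> 'I_k, injective i.
  by exists (fun b => val (e b)) => b c /val_inj/e_inj.
apply/card_leEx.
exists (fun s => SigSub (mem_set (I : [set: _] (g (val s))))) => s t [] /g_inj.
exact: val_inj.
Qed.
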